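(* Consider constructing, to errors $\mathcal O(\gamma^p)$, the slow manifold of the first-order wave PDE $u_t+cu_x=0$ on elements of equal length $H$ coupled by $$(1-\tfrac12\gamma)(u_j^R-u_j^L)=\tfrac12\gamma(u_{j+1}^L-u_{j-1}^R)+\tfrac12\gamma\theta(u_j^L+u_j^R)-\tfrac12\gamma\theta(u_{j+1}^L+u_{j-1}^R).$$ The resulting holistic discretisation, that is, the power series expansion in $\gamma$ of $$\partial_tU_j=-\frac{2c}{H}\operatorname{asinh}\left[\frac{\tfrac12\gamma(\mu_j-\tfrac12\theta\delta_j)\delta_j}{\sqrt{1+\tfrac12\gamma\delta_j^2-\gamma\theta\mu_j\delta_j+\tfrac14\gamma^2(\theta^2-1)\delta_j^2}}\right]U_j$$ truncated to errors $\mathcal O(\gamma^p)$ (all powers $\gamma^p$ and higher discarded), is: (i) a scheme of stencil width $(2p-1)$ on the macroscale grid; and (ii) consistent with the wave PDE to errors $\mathcal O(\partial_x^p)$.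
   Context: The elements $\mathbb X_j=(L_j,R_j)$, $R_j=L_{j+1}$, of length $H$ partition a periodic interval; $u_j$ satisfies the PDE on $\mathbb X_j$; superscripts $R,L$ denote evaluation at the right/left edges of the relevant element. $U_j(t)$ is the macroscale grid value (a local average, or midpoint value, of $u_j$ in the $j$th element). $c$ is the constant wave speed, $\gamma,\theta$ are real parameters, with full coupling being $\gamma=1$. $E_j^{\pm1}U_j=U_{j\pm1}$; $\delta_j=E_j^{1/2}-E_j^{-1/2}$, $\mu_j=\tfrac12(E_j^{1/2}+E_j^{-1/2})$, $\mu_j^2=1+\tfrac14\delta_j^2$; operator functions are interpreted as power series in the operators. Stencil width $(2p-1)$: the right-hand side for $\partial_tU_j$ involves only $U_{j-(p-1)},\ldots,U_{j+(p-1)}$. Consistency: interpolate $U_j(t)$ by a smooth field $U(t,x)$ with one step in $j$ being a step $H$ in $x$, so that $\delta_j=2\sinh(H\partial_x/2)$ and $\mu_j=\cosh(H\partial_x/2)$ as power series in $\partial_x$. ''Consistent to errors $\mathcal O(\partial_x^p)$'' means that at $\gamma=1$ the resulting equivalent PDE agrees with $\partial_tU=-c\,\partial_xU$ in all terms $\partial_x^qU$ with $q<p$. *)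

(* Defs.v *)
From HB Require Import structures.
From mathcomp Require Import all_boot all_order all_algebra.
From mathcomp Require Import all_classical all_reals all_analysis.
Set Implicit Arguments.
Unset Strict Implicit.
Unset Printing Implicit Defensive.
Import Order.TTheory GRing.Theory Num.Theory.
Import numFieldNormedType.Exports.
Local Open Scope classical_set_scope.
Local Open Scope ring_scope.

(** * Formal power series, given by their coefficients *)

Section PowerSeries.
Variable A : comNzRingType.

Definition fps := nat -> A.

Definition fps_mul (a b : fps) : fps :=
  fun n => \sum_(i < n.+1) a i * b (n - i)%N.

Definition fps_exp (a : fps) (k : nat) : fps :=
  iter k (fps_mul a) (fun n => (n == 0%N)%:R).

(* [f(z)], only meaningful when [z] has no constant term: then the [k]-th
   power of [z] does not contribute to the [n]-th coefficient for [k > n]. *)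
Definition fps_comp (f z : fps) : fps :=
  fun n => \sum_(k < n.+1) f k * fps_exp z k n.

End PowerSeries.

(** * Taylor coefficients at 0 *)

Section Taylor.
Variable R : realType.

(* [(1 + w)^(-1/2) = \sum_k binom(-1/2, k) w^k] *)
Definition rsqrt1p_coef (k : nat) : R :=
  (\prod_(i < k) (- 2^-1 - i%:R)) / k`!%:R.

(* [asinh' z = (1 + z^2)^(-1/2)] and [asinh 0 = 0] *)
Definition asinh_coef (k : nat) : R :=
  if odd k then rsqrt1p_coef k./2 / k%:R else 0.

(* [sinh (a z)] and [cosh (a z)] as power series in [z] *)
Definition sinh_coef (a : R) (k : nat) : R :=
  if odd k then a ^+ k / k`!%:R else 0.

Definition cosh_coef (a : R) (k : nat) : R :=
  if odd k then 0 else a ^+ k / k`!%:R.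

End Taylor.

(** * The closed form, expanded in powers of the coupling parameter *)

Section ClosedForm.
Variables (R : realType) (c H theta : R).

(* Polynomials in two commuting symbols: the outer variable stands for the
   centred difference [delta], the inner one for the centred mean [mu]. *)
Definition opPoly : comNzRingType := {poly {poly R}}.

Definition opC (a : R) : opPoly := a%:P%:P.
Definition delta_sym : opPoly := 'X.
Definition mu_sym : opPoly := ('X)%:P.

(* In [{poly opPoly}] the variable ['X] is the coupling parameter [gamma]. *)
Definition cf_num : {poly opPoly} :=
  (opC 2^-1 * (mu_sym - opC (2^-1 * theta) * delta_sym) * delta_sym) *: 'X.

(* the expression under the square root, without its leading 1 *)
Definition cf_rad : {poly opPoly} :=
  (opC 2^-1 * delta_sym ^+ 2) *: 'X - (opC theta * mu_sym * delta_sym) *: 'X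
  + (opC (4^-1 * (theta ^+ 2 - 1)) * delta_sym ^+ 2) *: 'X^2.

Definition cf_arg : fps opPoly :=
  fps_mul (fun n => cf_num`_n)
          (fps_comp (fun k => opC (rsqrt1p_coef R k)) (fun n => cf_rad`_n)).

(* [holistic_coef n] is the coefficient of [gamma ^ n] *)
Definition holistic_coef : fps opPoly :=
  fun n => opC (- (2 * c / H)) *
           fps_comp (fun k => opC (asinh_coef R k)) cf_arg n.

End ClosedForm.

(** * Operators on the grid *)

Section GridOperators.
Variable R : realType.

(* [delta] and [mu] involve half steps, so they act on functions of a real
   index [s]; the grid values are [U_j = V j%:~R] with [j : int]. *)
Definition delta_op (V : R -> R) : R -> R :=
  fun s => V (s + 2^-1) - V (s - 2^-1).

Definition mu_op (V : R -> R) : R -> R :=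
  fun s => 2^-1 * (V (s + 2^-1) + V (s - 2^-1)).

Definition apply_op (P : opPoly R) (V : R -> R) : R -> R :=
  fun s => \sum_(b < size P) \sum_(a < size P`_b)
             P`_b`_a * iter a mu_op (iter b delta_op V) s.

(* right-hand side of the discretisation, truncated to errors [O(gamma^p)] *)
Definition holistic_rhs (c H theta : R) (p : nat) (gamma : R) (V : R -> R) :
    R -> R :=
  fun s => \sum_(n < p) gamma ^+ n * apply_op (holistic_coef c H theta n) V s.

(* Only [U_{j-(p-1)}, ..., U_{j+(p-1)}] are involved: [2p-1] grid values, and
   no value at a half-integer index. *)
Definition stencil_width_2p_minus_1 (p : nat) (F : (R -> R) -> R -> R) : Prop :=
  exists a : 'I_(2 * p - 1) -> R, forall (V : R -> R) (j : int),
    F V j%:~R = \sum_(i < 2 * p - 1) a i * V (j + i%:Z - p.-1%:Z)%:~R.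

End GridOperators.

(** * Equivalent partial differential equation *)

Section EquivalentPDE.
Variable R : realType.

(* substitution of power series in [d/dx] for the symbols [mu] and [delta] *)
Definition subst_op (P : opPoly R) (m d : fps R) : fps R :=
  fun q => \sum_(b < size P) \sum_(a < size P`_b)
             P`_b`_a * fps_mul (fps_exp m a) (fps_exp d b) q.

(* coefficient of the [q]-th space derivative of [U] in the equivalent PDE:
   [mu = cosh (H d/dx / 2)] and [delta = 2 sinh (H d/dx / 2)] *)
Definition equivalent_pde (c H theta : R) (p : nat) (gamma : R) : fps R :=
  fun q => \sum_(n < p) gamma ^+ n *
    subst_op (holistic_coef c H theta n)
             (cosh_coef (H / 2)) (fun k => 2 * sinh_coef (H / 2) k) q.

(* agreement with [U_t = - c U_x] in all derivatives of order less than [p] *)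
Definition consistent_with_wave (c : R) (p : nat) (pde : fps R) : Prop :=
  forall q : nat, (q < p)%N -> pde q = if q == 1%N then - c else 0.

End EquivalentPDE.

(** * The slow manifold *)

Inductive grid_value_kind := Midpoint | Average.

Section SlowManifold.
Variables (R : realType) (c H theta x0 : R) (N : nat).
Variables (kind : grid_value_kind).

(* The periodic interval of length [N * H] is unrolled: elements and grid
   values are indexed by [int], with period [N]. *)
Definition Ledge (j : int) : R := x0 + j%:~R * H.
Definition Redge (j : int) : R := Ledge (j + 1).

Definition grid_periodic (U : int -> R) : Prop :=
  forall j : int, U (j + N%:Z) = U j.

Definition grid_value (j : int) (f : R -> R) : R :=
  match kind with
  | Midpoint => f ((Ledge j + Redge j) / 2)
  | Average =>
      H^-1 * \int[lebesgue_measure]_(x in `[Ledge j, Redge j]) f x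
  end.

(* The subgrid field is [u_j(x,t) = \sum_n gamma^n v n U(t) j x] and the
   evolution on the slow manifold is [dU_j/dt = \sum_n gamma^n g n U j]. *)
Variables (v : nat -> (int -> R) -> int -> R -> R).
Variables (g : nat -> (int -> R) -> int -> R).

(* By linearity of [v m] in [U], the time derivative of [v m U(t) j x] is
   [v m (dU/dt) j x]; this is its coefficient of [gamma ^ n]. *)
Definition field_dt (n : nat) (U : int -> R) (j : int) (x : R) : R :=
  \sum_(m < n.+1) v m (g (n - m)%N U) j x.

(* edge values modulo [gamma ^ p], as polynomials in [gamma = 'X] *)
Definition uL (p : nat) (U : int -> R) (j : int) : {poly R} :=
  \poly_(n < p) v n U j (Ledge j).
Definition uR (p : nat) (U : int -> R) (j : int) : {poly R} :=
  \poly_(n < p) v n U j (Redge j).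

Definition coupling_lhs (p : nat) (U : int -> R) (j : int) : {poly R} :=
  (1 - 2^-1 *: 'X) * (uR p U j - uL p U j).
Definition coupling_rhs (p : nat) (U : int -> R) (j : int) : {poly R} :=
  (2^-1 *: 'X) * (uL p U (j + 1) - uR p U (j - 1))
  + ((2^-1 * theta) *: 'X) * (uL p U j + uR p U j)
  - ((2^-1 * theta) *: 'X) * (uL p U (j + 1) + uR p U (j - 1)).

Record slow_manifold (p : nat) : Prop := SlowManifold {
  sm_g_periodic : forall n U, (n < p)%N -> grid_periodic U -> grid_periodic (g n U);
  sm_v_periodic : forall n U j x, (n < p)%N -> grid_periodic U ->
    x \in `[Ledge j, Redge j] ->
    v n U (j + N%:Z) (x + N%:R * H) = v n U j x;
  sm_g_linear : forall n a U W j, (n < p)%N -> grid_periodic U -> grid_periodic W ->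
    g n (fun i => a * U i + W i) j = a * g n U j + g n W j;
  sm_v_linear : forall n a U W j x, (n < p)%N -> grid_periodic U -> grid_periodic W ->
    x \in `[Ledge j, Redge j] ->
    v n (fun i => a * U i + W i) j x = a * v n U j x + v n W j x;
  (* base of the expansion: at [gamma = 0] the slow subspace of fields that
     are constant on each element *)
  sm_base : forall U j x, grid_periodic U -> x \in `[Ledge j, Redge j] ->
    v 0%N U j x = U j;
  sm_grid_value : forall n U j, (n < p)%N -> grid_periodic U ->
    grid_value j (v n U j) = if n == 0%N then U j else 0;
  sm_continuous : forall n U j, (n < p)%N -> grid_periodic U ->
    {within `[Ledge j, Redge j], continuous (v n U j)};
  sm_derivable : forall n U j x, (n < p)%N -> grid_periodic U ->
    x \in `]Ledge j, Redge j[ -> derivable (v n U j) x 1;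
  sm_pde : forall n U j x, (n < p)%N -> grid_periodic U ->
    x \in `]Ledge j, Redge j[ ->
    field_dt n U j x + c * derive1 (v n U j) x = 0;
  sm_coupling : forall U j, grid_periodic U ->
    take_poly p (coupling_lhs p U j) = take_poly p (coupling_rhs p U j) }.

End SlowManifold.

(* Main.v *)
Require Import Defs.
From HB Require Import structures.
From mathcomp Require Import all_boot all_order all_algebra.
From mathcomp Require Import all_classical all_reals all_analysis.
From mathcomp Require Import ring lra zify.
Set Implicit Arguments.
Unset Strict Implicit.
Unset Printing Implicit Defensive.
Import Order.TTheory GRing.Theory Num.Theory.
Import numFieldNormedType.Exports.
Local Open Scope classical_set_scope.
Local Open Scope ring_scope.

(** Let [A] be the power series [asinh [...]] in [gamma].  On each element the
    slow field is [exp (2 A (x - x_mid) / H) U_j], up to a constant factor that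
    enforces the definition of [U_j], so that its edge values are multiples of
    [exp (A) U_j] and [exp (- A) U_j] and it solves the wave equation with
    [dU_j/dt = - (2 c / H) A U_j].  The coupling condition then reads
    [(1 + gamma delta^2 / 4 - gamma theta mu delta / 2) sinh A =
     gamma / 2 (mu - theta delta / 2) delta cosh A]; after
    division by [gamma / 2 (mu - theta delta / 2) delta] both sides are series
    with constant term 1, and their squares agree because
    [mu^2 = 1 + delta^2 / 4].  Conversely the coefficients of a slow manifold
    are determined order by order in [gamma]: two candidates differ by a
    function of constant slope on each element, and the coupling condition
    makes this slope vanish.

    The coefficient of [gamma ^ n] is a combination of products of at most [n]
    factors [mu delta] and [delta^2], which gives the stencil, and it has order
    at least [n] in [d/dx].  At [gamma = 1] the argument of [asinh] becomes
    [delta / 2 = sinh (H d/dx / 2)], hence the exact wave equation up to the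
    truncation. *)

(** * Ring of formal power series *)

Section FpsRing.
Variable A : comNzRingType.
Implicit Types (a b c : fps A) (p q : {poly A}) (n m k : nat).

Definition fps_trunc m a : {poly A} := \poly_(i < m) a i.

(** Coefficient [n] of a product only sees coefficients of index at most [n], so the ring laws and
    the Leibniz rule can be borrowed from polynomials. *)
Lemma fps_mul_trunc m a b n : (n < m)%N ->
  fps_mul a b n = (fps_trunc m a * fps_trunc m b)`_n.
Proof.
move=> nm; rewrite coefM; apply: eq_bigr => i _; rewrite !coef_poly.
have im : (i < m)%N by rewrite (leq_ltn_trans _ nm) // -ltnS.
by rewrite im (leq_ltn_trans (leq_subr _ _) nm).
Qed.

Lemma coefM_eq p p' q q' n : (forall i, (i <= n)%N -> p`_i = p'`_i) ->
  (forall i, (i <= n)%N -> q`_i = q'`_i) -> (p * q)`_n = (p' * q')`_n.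
Proof.
move=> pp qq; rewrite !coefM; apply: eq_bigr => i _.
by rewrite pp ?qq // ?leq_subr // -ltnS.
Qed.

Definition fps_add a b : fps A := fun n => a n + b n.
Definition fps_opp a : fps A := fun n => - a n.
Definition fps_zero : fps A := fun=> 0.
Definition fps_one : fps A := fun n => (n == 0%N)%:R.

Lemma fps_addA : associative fps_add.
Proof. by move=> a b c; apply/funext => n; rewrite /fps_add addrA. Qed.
Lemma fps_addC : commutative fps_add.
Proof. by move=> a b; apply/funext => n; rewrite /fps_add addrC. Qed.
Lemma fps_add0 : left_id fps_zero fps_add.
Proof. by move=> a; apply/funext => n; rewrite /fps_add add0r. Qed.
Lemma fps_addN : left_inverse fps_zero fps_opp fps_add.
Proof. by move=> a; apply/funext => n; rewrite /fps_add addNr. Qed.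

Lemma fps_mulA : associative (@fps_mul A).
Proof.
move=> a b c; apply/funext => n.
rewrite !(fps_mul_trunc _ _ (ltnSn n)).
transitivity (fps_trunc n.+1 a * (fps_trunc n.+1 b * fps_trunc n.+1 c))`_n.
  apply: coefM_eq => // i ni.
  by rewrite coef_poly ltnS ni (fps_mul_trunc _ _ (m := n.+1)).
rewrite mulrA; apply: coefM_eq => // i ni.
by rewrite [RHS]coef_poly ltnS ni (fps_mul_trunc _ _ (m := n.+1)).
Qed.
Lemma fps_mulC : commutative (@fps_mul A).
Proof.
by move=> a b; apply/funext => n; rewrite !(fps_mul_trunc _ _ (ltnSn n)) mulrC.
Qed.
Lemma fps_mul1 : left_id fps_one (@fps_mul A).
Proof.
move=> a; apply/funext => n.
rewrite /fps_mul big_ord_recl /= subn0 mul1r big1 ?addr0 // => i _.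
by rewrite /fps_one /= mul0r.
Qed.
Lemma fps_mulDl : left_distributive (@fps_mul A) fps_add.
Proof.
move=> a b c; apply/funext => n; rewrite /fps_mul /fps_add -big_split /=.
by apply: eq_bigr => i _; rewrite mulrDl.
Qed.
Lemma fps_oner_neq0 : fps_one != fps_zero.
Proof.
apply/eqP => /(congr1 (fun f : fps A => f 0%N)) /=.
by apply/eqP; rewrite oner_eq0.
Qed.

(* Keyed on [fps]: the type [nat -> A] already carries the pointwise product. *)
HB.instance Definition _ := Choice.copy (fps A) (nat -> A).
HB.instance Definition _ := GRing.isZmodule.Build (fps A)
  fps_addA fps_addC fps_add0 fps_addN.
HB.instance Definition _ := GRing.Zmodule_isComNzRing.Build (fps A)
  fps_mulA fps_mulC fps_mul1 fps_mulDl fps_oner_neq0.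
End FpsRing.

Section FpsCoef.
Variable A : comNzRingType.
Implicit Types (a b c : fps A) (p q : {poly A}) (n m k : nat).

Lemma fps_coefD a b n : (a + b : fps A) n = a n + b n. Proof. by []. Qed.
Lemma fps_coefN a n : (- a : fps A) n = - a n. Proof. by []. Qed.
Lemma fps_coefB a b n : (a - b : fps A) n = a n - b n. Proof. by []. Qed.
Lemma fps_coef1 n : (1 : fps A) n = (n == 0%N)%:R. Proof. by []. Qed.
Lemma fps_mulE a b : fps_mul a b = a * b. Proof. by []. Qed.
Lemma fps_coefM a b n : (a * b : fps A) n = \sum_(i < n.+1) a i * b (n - i)%N.
Proof. by []. Qed.
Lemma fps_coefM_trunc m a b n : (n < m)%N ->
  (a * b : fps A) n = (fps_trunc m a * fps_trunc m b)`_n.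
Proof. exact: fps_mul_trunc. Qed.
Lemma fps_coef_sum (I : Type) (r : seq I) (P : pred I) (F : I -> fps A) n :
  (\sum_(i <- r | P i) F i) n = \sum_(i <- r | P i) F i n.
Proof. by elim/big_rec2: _ => // i x y _ <-. Qed.
Lemma fps_expE a k : fps_exp a k = a ^+ k.
Proof. by elim: k => [|k IH] //; rewrite exprS -IH. Qed.
Lemma fps_coef0M a b : (a * b : fps A) 0%N = a 0%N * b 0%N.
Proof. by rewrite fps_coefM big_ord1. Qed.

Lemma fps_coefM_eq a a' b b' n : (forall i, (i <= n)%N -> a i = a' i) ->
  (forall i, (i <= n)%N -> b i = b' i) -> (a * b : fps A) n = (a' * b' : fps A) n.
Proof.
move=> aa bb; rewrite !fps_coefM; apply: eq_bigr => i _.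
by rewrite aa ?bb // ?leq_subr // -ltnS.
Qed.

Definition fps_of_poly p : fps A := fun n => p`_n.
Lemma fps_of_poly_additive : zmod_morphism fps_of_poly.
Proof. by move=> p q; apply/funext => n; rewrite /fps_of_poly coefB. Qed.
Lemma fps_of_poly_multiplicative : monoid_morphism fps_of_poly.
Proof.
split=> [|p q]; apply/funext => n; rewrite /fps_of_poly.
  by rewrite coef1.
by rewrite coefM fps_coefM.
Qed.
HB.instance Definition _ := GRing.isZmodMorphism.Build {poly A} (fps A)
  fps_of_poly fps_of_poly_additive.
HB.instance Definition _ := GRing.isMonoidMorphism.Build {poly A} (fps A)
  fps_of_poly fps_of_poly_multiplicative.

Definition fpsC (x : A) : fps A := fps_of_poly x%:P.
HB.instance Definition _ := GRing.RMorphism.copy fpsC (fps_of_poly \o polyC).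
Definition fpsX : fps A := fps_of_poly 'X.

Lemma fps_coefCM x a n : (fpsC x * a) n = x * a n.
Proof.
rewrite fps_coefM big_ord_recl /= /fpsC /fps_of_poly coefC /= subn0 big1 ?addr0 //.
by move=> i _; rewrite coefC /= mul0r.
Qed.
Lemma fps_coefXM a n : (fpsX * a) n = if n is n'.+1 then a n' else 0.
Proof.
case: n => [|n]; rewrite fps_coefM big_ord_recl /fpsX /fps_of_poly coefX mul0r add0r.
  by rewrite big_ord0.
rewrite big_ord_recl /= coefX mul1r subSS subn0 big1 ?addr0 // => i _.
by rewrite coefX /= mul0r.
Qed.
Lemma fps_coefMn a k n : (a *+ k : fps A) n = a n *+ k.
Proof. by elim: k => [|k IH] //; rewrite !mulrS -IH. Qed.

Definition fps_deriv a : fps A := fun n => a n.+1 *+ n.+1.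

Lemma fps_derivD a b : fps_deriv (a + b) = fps_deriv a + fps_deriv b.
Proof. by apply/funext => n; rewrite /fps_deriv !fps_coefD mulrnDl. Qed.
Lemma fps_derivN a : fps_deriv (- a) = - fps_deriv a.
Proof. by apply/funext => n; rewrite /fps_deriv !fps_coefN mulNrn. Qed.
Lemma fps_derivB a b : fps_deriv (a - b) = fps_deriv a - fps_deriv b.
Proof. by rewrite fps_derivD fps_derivN. Qed.
Lemma fps_derivM a b :
  fps_deriv (a * b) = fps_deriv a * b + a * fps_deriv b.
Proof.
apply/funext => n; rewrite /fps_deriv.
rewrite (fps_coefM_trunc _ _ (ltnSn n.+1)) -coef_deriv derivM coefD fps_coefD.
rewrite !(fps_coefM_trunc _ _ (ltnSn n)).
congr (_ + _); apply: coefM_eq => i ni; rewrite ?coef_deriv !coef_poly.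
- by rewrite !ltnS ni.
- by rewrite !ltnS ni leqW.
- by rewrite !ltnS ni leqW.
- by rewrite !ltnS ni.
Qed.
Lemma fps_deriv1 : fps_deriv 1 = 0.
Proof. by apply/funext => n; rewrite /fps_deriv fps_coef1 mul0rn. Qed.
Lemma fps_derivC x : fps_deriv (fpsC x) = 0.
Proof. by apply/funext => n; rewrite /fps_deriv /fpsC /fps_of_poly coefC mul0rn. Qed.
Lemma fps_derivXn a k : fps_deriv (a ^+ k.+1) = (a ^+ k * fps_deriv a) *+ k.+1.
Proof.
elim: k => [|k IH]; first by rewrite expr1 expr0 mul1r.
rewrite exprS fps_derivM IH [in RHS]mulrS exprS; congr (_ + _).
  by rewrite mulrC -exprS.
by rewrite mulrnAr mulrA.
Qed.

Lemma fps_exp_coef_small a k n : a 0%N = 0 -> (n < k)%N -> (a ^+ k) n = 0.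
Proof.
move=> a0; elim: k n => [|k IH] n // nk.
rewrite exprS fps_coefM big_ord_recl a0 mul0r add0r big1 // => i _.
by rewrite IH ?mulr0 //= /bump /= add1n; move: nk; case: n i => [[]|n i] // ?; rewrite subSS (leq_ltn_trans (leq_subr _ _)).
Qed.

(** Powers above [n] contribute nothing to coefficient [n], so any longer truncation may be used;
    near that coefficient a composite is then an ordinary polynomial in [a]. *)
Lemma fps_comp_coef (f a : fps A) m n : a 0%N = 0 -> (n < m)%N ->
  fps_comp f a n = (\sum_(k < m) fpsC (f k) * a ^+ k) n.
Proof.
move=> a0 nm; rewrite fps_coef_sum /fps_comp.
under [RHS]eq_bigr do rewrite fps_coefCM.
rewrite (big_ord_widen m (fun k => f k * fps_exp a k n)) //.
rewrite big_mkcond; apply: eq_bigr => k _; rewrite fps_expE; case: ifP => // /negbT.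
by rewrite -leqNgt => kn; rewrite fps_exp_coef_small ?mulr0.
Qed.

Lemma fps_comp_coef0 (f a : fps A) : fps_comp f a 0%N = f 0%N.
Proof. by rewrite /fps_comp big_ord1 fps_expE expr0 fps_coef1 mulr1. Qed.

Lemma fps_compD (f g a : fps A) : fps_comp (f + g) a = fps_comp f a + fps_comp g a.
Proof.
apply/funext => n; rewrite fps_coefD /fps_comp -big_split /=.
by apply: eq_bigr => k _; rewrite fps_coefD mulrDl.
Qed.
Lemma fps_compCM x (f a : fps A) : fps_comp (fpsC x * f) a = fpsC x * fps_comp f a.
Proof.
apply/funext => n; rewrite fps_coefCM /fps_comp mulr_sumr.
by apply: eq_bigr => k _; rewrite fps_coefCM mulrA.
Qed.
Lemma fps_comp1 a : fps_comp 1 a = 1.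
Proof.
apply/funext => n; rewrite /fps_comp big_ord_recl fps_coef1 mul1r fps_expE expr0.
by rewrite big1 ?addr0 // => i _; rewrite fps_coef1 mul0r.
Qed.
(** Together with additivity and scaling, this carries a differential equation with polynomial
    coefficients through the substitution of [a]. *)
Lemma fps_compXM (f a : fps A) : a 0%N = 0 ->
  fps_comp (fpsX * f) a = a * fps_comp f a.
Proof.
move=> a0; apply/funext => n.
rewrite (fps_comp_coef _ a0 (ltnSn n)) big_ord_recl fps_coefXM rmorph0 mul0r add0r.
transitivity ((a * \sum_(k < n.+1) fpsC (f k) * a ^+ k) n).
  rewrite big_ord_recr mulrDr fps_coefD /= mulrCA -exprS fps_coefCM.
  rewrite (fps_exp_coef_small (k := n.+1)) // mulr0 addr0 mulr_sumr !fps_coef_sum.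
  by apply: eq_bigr => i _; rewrite fps_coefXM /= mulrCA -exprS.
by apply: fps_coefM_eq => // i ni; rewrite -(fps_comp_coef _ a0).
Qed.

(** Chain rule, obtained by differentiating a truncation of the composite term by term. *)
Lemma fps_deriv_comp (f a : fps A) : a 0%N = 0 ->
  fps_deriv (fps_comp f a) = fps_comp (fps_deriv f) a * fps_deriv a.
Proof.
move=> a0; apply/funext => n.
rewrite {1}/fps_deriv (fps_comp_coef _ a0 (ltnSn n.+1)) fps_coef_sum -sumrMnl.
rewrite big_ord_recl fps_coefCM expr0 fps_coef1 mulr0 mul0rn add0r.
transitivity (((\sum_(k < n.+1) fpsC (fps_deriv f k) * a ^+ k) * fps_deriv a) n).
  rewrite mulr_suml fps_coef_sum; apply: eq_bigr => i _.
  rewrite fps_coefCM -mulrA fps_coefCM -mulrnAr.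
  have -> : (a ^+ i.+1) n.+1 *+ n.+1 = fps_deriv (a ^+ i.+1) n by [].
  by rewrite fps_derivXn fps_coefMn mulrnAr /fps_deriv mulrnAl.
by apply: fps_coefM_eq => // i ni; rewrite -(fps_comp_coef _ a0).
Qed.

End FpsCoef.

(** * Binomial and inverse hyperbolic series *)

Section FpsOverReals.
Variables (R : realType) (A : comNzRingType) (iota : {rmorphism R -> A}).
Implicit Types (a b w y z : fps A) (f : fps R).

Definition fps_map f : fps A := fun n => iota (f n).

(** The morphism [iota] supplies an inverse of [n.+1] in [A], so the additive group is torsion
    free. *)
Lemma mulrSn_eq0 (x : A) n : x *+ n.+1 = 0 -> x = 0.
Proof.
move=> x0; have n0 : n.+1%:R != 0 :> R by rewrite pnatr_eq0.
rewrite -[x]mul1r -(rmorph1 iota) -(mulVf n0) rmorphM rmorph_nat -mulrA.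
by rewrite mulr_natl x0 mulr0.
Qed.

(** In [y' = b y], coefficient [n.+1] of [y] is fixed, up to the factor [n.+1], by the coefficients
    up to [n]. *)
Lemma fps_ode_unique b y y' : fps_deriv y = b * y -> fps_deriv y' = b * y' ->
  y 0%N = y' 0%N -> y = y'.
Proof.
move=> Dy Dy' y0; suff E n : forall i, (i <= n)%N -> y i = y' i.
  by apply/funext => n; exact: (E n).
elim: n => [|n IH] i; first by rewrite leqn0 => /eqP ->.
rewrite leq_eqVlt ltnS => /orP[/eqP ->|]; last exact: IH.
apply/eqP; rewrite -subr_eq0; apply/eqP; apply: (@mulrSn_eq0 _ n).
rewrite mulrnBl; apply/eqP; rewrite subr_eq0; apply/eqP.
have -> : y n.+1 *+ n.+1 = fps_deriv y n by [].
have -> : y' n.+1 *+ n.+1 = fps_deriv y' n by [].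
by rewrite Dy Dy'; apply: fps_coefM_eq.
Qed.

Lemma fps_deriv_eq0 y x : fps_deriv y = 0 -> y 0%N = x -> y = fpsC x.
Proof.
move=> Dy y0; apply: (@fps_ode_unique 0); rewrite ?mul0r ?fps_derivC //.
by rewrite /fpsC /fps_of_poly coefC.
Qed.

Lemma rsqrt1p_coefS k :
  rsqrt1p_coef R k.+1 *+ k.+1 = (- 2^-1 - k%:R) * rsqrt1p_coef R k.
Proof.
rewrite /rsqrt1p_coef big_ord_recr /= factS natrM.
have n0 : k.+1%:R != 0 :> R by rewrite pnatr_eq0.
have f0 : k`!%:R != 0 :> R by rewrite pnatr_eq0 -lt0n fact_gt0.
by rewrite -mulr_natr; field; rewrite f0 nat1r n0.
Qed.

(** The equation [(1 + X) y' = - y / 2] of [(1 + X)^(-1/2)]; coefficientwise it is the recursion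
    [rsqrt1p_coefS]. *)
Lemma rsqrt1p_ode :
  (1 + fpsX A) * fps_deriv (fps_map (rsqrt1p_coef R)) =
  - (fpsC (iota 2^-1) * fps_map (rsqrt1p_coef R)).
Proof.
apply/funext => n; rewrite mulrDl mul1r fps_coefD fps_coefXM fps_coefN fps_coefCM.
rewrite /fps_deriv /fps_map -rmorphMn rsqrt1p_coefS.
case: n => [|n].
  by rewrite addr0 -rmorphM -rmorphN; congr (iota _); ring.
rewrite -rmorphMn -rmorphD -rmorphM -rmorphN; congr (iota _).
by rewrite -mulr_natr; ring.
Qed.

(** By the differential equation the left side has zero derivative, so it equals its constant
    term. *)
Lemma rsqrt1p_comp_sqr w : w 0%N = 0 ->
  fps_comp (fps_map (rsqrt1p_coef R)) w ^+ 2 * (1 + w) = 1.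
Proof.
move=> w0; set r := fps_comp _ w.
have half : fpsC (iota 2^-1) * 2 = 1 :> fps A.
  by rewrite -(rmorph_nat (@fpsC A)) -(rmorph_nat iota) -!rmorphM mulVf ?rmorph1 ?pnatr_eq0.
have Dr : (1 + w) * fps_deriv r = - (fpsC (iota 2^-1) * r * fps_deriv w).
  rewrite fps_deriv_comp // mulrA.
  have <- : fps_comp ((1 + fpsX A) * fps_deriv (fps_map (rsqrt1p_coef R))) w =
     (1 + w) * fps_comp (fps_deriv (fps_map (rsqrt1p_coef R))) w.
    by rewrite !mulrDl !mul1r fps_compD fps_compXM.
  by rewrite rsqrt1p_ode -mulNr -(rmorphN (@fpsC A)) fps_compCM rmorphN !mulNr.
rewrite (@fps_deriv_eq0 (r ^+ 2 * (1 + w)) 1) ?rmorph1 //.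
  rewrite fps_derivM fps_derivXn fps_derivD fps_deriv1 add0r expr1.
  transitivity (2 * r * ((1 + w) * fps_deriv r) + r ^+ 2 * fps_deriv w); first by ring.
  rewrite Dr.
  transitivity ((1 - fpsC (iota 2^-1) * 2) * r ^+ 2 * fps_deriv w); first by ring.
  by rewrite half subrr !mul0r.
rewrite expr2 !fps_coef0M fps_coefD fps_coef1 w0 addr0 mulr1 /r fps_comp_coef0.
by rewrite /fps_map /rsqrt1p_coef big_ord0 fact0 divr1 rmorph1 mulr1.
Qed.

Lemma asinh_ode :
  (1 + fpsX A * fpsX A) * fps_deriv (fps_deriv (fps_map (asinh_coef R))) =
  - (fpsX A * fps_deriv (fps_map (asinh_coef R))).
Proof.
(* The derivative of asinh is the series of [(1 + X^2)^(-1/2)]: the binomial coefficients sit at the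
   even indices. *)
have q n : fps_deriv (fps_map (asinh_coef R)) n =
    iota (if odd n then 0 else rsqrt1p_coef R n./2).
  rewrite /fps_deriv /fps_map /asinh_coef /= -rmorphMn; congr (iota _).
  case: (boolP (odd n)) => on /=; first by rewrite mul0rn.
  by rewrite uphalf_half (negbTE on) add0n -mulr_natr divfK // pnatr_eq0.
apply/funext => n; rewrite mulrDl mul1r -mulrA fps_coefD fps_coefN !fps_coefXM.
rewrite {1}/fps_deriv q /=.
case: n => [|n] /=; first by rewrite rmorph0 mul0rn addr0 oppr0.
rewrite fps_coefXM q; case: n => [|n] /=.
  rewrite addr0 -rmorphMn -rmorphN; congr (iota _).
  rewrite /rsqrt1p_coef big_ord_recl !big_ord0 /= fact0 mulr1 mulr2n.
  by rewrite (_ : 1`! = 1%N) //; lra.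
rewrite {1}/fps_deriv q /= -!rmorphMn -rmorphD -rmorphN; congr (iota _).
rewrite negbK; case: (boolP (odd n)) => on; last by rewrite !mul0rn addr0 oppr0.
(* For odd [n], both [n.+1] and [n.+3] are doubles of consecutive integers, which reduces the claim
   to the binomial recursion. *)
have -> : n.+3 = (n./2.+2).*2 by rewrite doubleS -[in LHS](odd_double_half n) on.
have -> : n.+1 = (n./2.+1).*2 by rewrite doubleS -[in LHS](odd_double_half n) on.
rewrite -!muln2 !mulrnA.
rewrite uphalf_half on add1n rsqrt1p_coefS /=; set r := rsqrt1p_coef R _.
by field.
Qed.

Definition exp_coef : fps R := fun k => k`!%:R^-1.

Lemma exp_ode : fps_deriv (fps_map exp_coef) = fps_map exp_coef.
Proof.
apply/funext => n; rewrite /fps_deriv /fps_map -rmorphMn /exp_coef; congr (iota _).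
rewrite -mulr_natr factS natrM invfM -mulrA [_ * n.+1%:R]mulrC mulrA mulVf ?mul1r //.
Qed.

Section AsinhComp.
Variables (z : fps A).
Hypothesis z0 : z 0%N = 0.
(** [rho] is the derivative of asinh at [z], that is [(1 + z^2)^(-1/2)]; multiplying it by [1 + z^2]
    gives the square root without a second binomial series. *)
Let rho := fps_comp (fps_deriv (fps_map (asinh_coef R))) z.
Let sigma := (1 + z ^+ 2) * rho.
Let a := fps_comp (fps_map (asinh_coef R)) z.

Lemma asinh_comp_coef0 : a 0%N = 0.
Proof. by rewrite /a fps_comp_coef0 /fps_map rmorph0. Qed.

Lemma asinh_comp_deriv : fps_deriv a = rho * fps_deriv z.
Proof. by rewrite fps_deriv_comp. Qed.

Lemma asinh_rho0 : rho 0%N = 1.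
Proof.
rewrite /rho fps_comp_coef0 /fps_deriv /fps_map /asinh_coef /=.
by rewrite /rsqrt1p_coef big_ord0 fact0 !divr1 rmorph1.
Qed.

Lemma asinh_rho_ode : (1 + z ^+ 2) * fps_deriv rho = - (z * rho * fps_deriv z).
Proof.
rewrite fps_deriv_comp // mulrA.
have <- : fps_comp ((1 + fpsX A * fpsX A) *
    fps_deriv (fps_deriv (fps_map (asinh_coef R)))) z =
  (1 + z ^+ 2) * fps_comp (fps_deriv (fps_deriv (fps_map (asinh_coef R)))) z.
  by rewrite !mulrDl !mul1r -mulrA fps_compD !fps_compXM // mulrA -expr2.
rewrite asinh_ode -[- (fpsX A * _)]mul1r mulrN -mulNr -(rmorph1 (@fpsC A)) -rmorphN.
by rewrite fps_compCM fps_compXM // rmorphN rmorph1 mulN1r mulNr.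
Qed.

Lemma asinh_rho_sqr : rho ^+ 2 * (1 + z ^+ 2) = 1.
Proof.
rewrite (@fps_deriv_eq0 (rho ^+ 2 * (1 + z ^+ 2)) 1) ?rmorph1 //.
  rewrite fps_derivM !fps_derivXn fps_derivD fps_deriv1 add0r !fps_derivXn !expr1.
  transitivity (2 * rho * ((1 + z ^+ 2) * fps_deriv rho)
     + 2 * rho ^+ 2 * z * fps_deriv z); first by ring.
  by rewrite asinh_rho_ode; ring.
by rewrite !expr2 !fps_coef0M fps_coefD fps_coef0M z0 asinh_rho0 fps_coef1 mul0r addr0 !mulr1.
Qed.

Lemma exp_comp_coef0 y : fps_comp (fps_map exp_coef) y 0%N = 1.
Proof. by rewrite fps_comp_coef0 /fps_map /exp_coef fact0 invr1 rmorph1. Qed.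

(* [sigma] is [sqrt (1 + z ^ 2)]; both sides solve [y' = a' y]. *)
Lemma exp_asinh : fps_comp (fps_map exp_coef) a = sigma + z.
Proof.
apply: (@fps_ode_unique (fps_deriv a)).
- by rewrite fps_deriv_comp ?asinh_comp_coef0 // exp_ode mulrC.
- rewrite asinh_comp_deriv /sigma fps_derivD fps_derivM fps_derivD fps_deriv1 add0r.
  rewrite fps_derivXn expr1 asinh_rho_ode.
  transitivity (z * fps_deriv z * rho + (rho ^+ 2 * (1 + z ^+ 2)) * fps_deriv z).
    by rewrite asinh_rho_sqr; ring.
  by ring.
- rewrite exp_comp_coef0 fps_coefD /sigma fps_coef0M fps_coefD expr2 fps_coef0M z0.
  by rewrite asinh_rho0 fps_coef1 mul0r !addr0 mulr1.
Qed.

Lemma exp_asinhN : fps_comp (fps_map exp_coef) (- a) = sigma - z.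
Proof.
apply: (@fps_ode_unique (- fps_deriv a)).
- by rewrite fps_deriv_comp ?fps_coefN ?asinh_comp_coef0 ?oppr0 // exp_ode mulrC fps_derivN.
- rewrite asinh_comp_deriv /sigma fps_derivB fps_derivM fps_derivD fps_deriv1 add0r.
  rewrite fps_derivXn expr1 asinh_rho_ode.
  transitivity (z * fps_deriv z * rho - (rho ^+ 2 * (1 + z ^+ 2)) * fps_deriv z).
    by rewrite asinh_rho_sqr; ring.
  by ring.
- rewrite exp_comp_coef0 fps_coefB /sigma fps_coef0M fps_coefD expr2 fps_coef0M z0.
  by rewrite asinh_rho0 fps_coef1 mul0r subr0 !addr0 mulr1.
Qed.

End AsinhComp.

(** A series with invertible constant term can be cancelled modulo an ideal: the coefficients of [d]
    are recovered one after the other from those of [d * s]. *)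
Lemma ideal_cancel (I : A -> Prop) (d s : fps A) (u : R) : I 0 ->
  (forall x y : A, I x -> I y -> I (x + y)) -> (forall x y : A, I y -> I (x * y)) ->
  s 0%N = iota u -> u != 0 -> (forall n, I ((d * s) n)) -> forall n, I (d n).
Proof.
move=> I0 ID IM s0 u0 ds; suff E n : forall i, (i <= n)%N -> I (d i).
  by move=> n; exact: (E n).
elim: n => [|n IH] i.
  rewrite leqn0 => /eqP ->; have := IM (iota u^-1) _ (ds 0%N).
  by rewrite fps_coef0M s0 mulrCA -rmorphM mulVf // rmorph1 mulr1.
rewrite leq_eqVlt ltnS => /orP[/eqP ->|]; last exact: IH.
have := ds n.+1; rewrite fps_coefM big_ord_recr /= subnn s0 => dsn.
have sI : I (- \sum_(i < n.+1) d i * s (n.+1 - i)%N).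
  rewrite -mulN1r; apply: (IM); elim/big_rec: _ => // k x _ Ix; apply: (ID) => //.
  by rewrite mulrC; apply: (IM); apply: IH; rewrite -ltnS.
have := IM (iota u^-1) _ (ID _ _ dsn sI).
by rewrite addrAC subrr add0r mulrCA -rmorphM mulVf // rmorph1 mulr1.
Qed.
End FpsOverReals.

(** * Filtered series and inverses *)

Section Filtration.
Variables (R : realType) (A : comNzRingType) (iota : {rmorphism R -> A}).

(** Abstract bookkeeping shared by two gradings: the stencil radius, which bounds from above, and
    the order in [d/dx], which bounds from below. No monotonicity in [n] is built in, since the two
    run in opposite directions. *)
Record filtration (F : nat -> A -> Prop) : Prop := Filtration {
  filtration0 : forall n, F n 0;
  filtrationD : forall n x y, F n x -> F n y -> F n (x + y);
  filtrationM : forall m n x y, F m x -> F n y -> F (m + n)%N (x * y);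
  filtrationC : forall u, F 0%N (iota u) }.

Variable F : nat -> A -> Prop.
Hypothesis FF : filtration F.

Definition fps_filtered (a : fps A) := forall n, F n (a n).

Lemma filtered_sum n (I : Type) (r : seq I) (P : pred I) (G : I -> A) :
  (forall i, P i -> F n (G i)) -> F n (\sum_(i <- r | P i) G i).
Proof.
move=> FG; elim/big_rec: _ => [|i x Pi Fx]; first exact: filtration0.
by apply: filtrationD => //; apply: FG.
Qed.

Lemma fps_filteredM a b : fps_filtered a -> fps_filtered b -> fps_filtered (a * b).
Proof.
move=> Fa Fb n; rewrite fps_coefM; apply: filtered_sum => i _.
have -> : F n = F (i + (n - i))%N by rewrite subnKC // -ltnS.
exact: filtrationM.
Qed.

Lemma fps_filtered1 : fps_filtered 1.
Proof.
case=> [|n]; rewrite fps_coef1 /=; last exact: filtration0.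
by have := filtrationC FF 1; rewrite rmorph1.
Qed.

Lemma fps_filteredX a k : fps_filtered a -> fps_filtered (a ^+ k).
Proof.
move=> Fa; elim: k => [|k IH]; first by rewrite expr0; exact: fps_filtered1.
by rewrite exprS; apply: fps_filteredM.
Qed.

Lemma filteredC u n x : F n x -> F n (iota u * x).
Proof. by move=> Fx; rewrite -[n]add0n; apply: filtrationM => //; exact: filtrationC. Qed.

Lemma fps_filteredC u a : fps_filtered a -> fps_filtered (fpsC (iota u) * a).
Proof. by move=> Fa n; rewrite fps_coefCM; apply: filteredC. Qed.

Lemma fps_filtered_comp (f : fps R) a :
  fps_filtered a -> fps_filtered (fps_comp (fps_map iota f) a).
Proof.
move=> Fa n; rewrite /fps_comp; apply: filtered_sum => i _.
by rewrite fps_expE; apply: filteredC; apply: fps_filteredX.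
Qed.
End Filtration.

Section Inverse.
Variables (R : realType) (A : comNzRingType) (iota : {rmorphism R -> A}).

(** Geometric series in [1 - a], meaningful when [a] has constant term 1. *)
Definition fps_inv (a : fps A) : fps A := fps_comp (fps_map iota (fun=> 1)) (1 - a).

Lemma fps_mulV (a : fps A) : a 0%N = 1 -> fps_inv a * a = 1.
Proof.
move=> a0; rewrite /fps_inv; set f : fps A := fps_map _ _.
have b0 : (1 - a) 0%N = 0 by rewrite fps_coefB fps_coef1 a0 subrr.
have fE : f = 1 + fpsX A * f.
  apply/funext => n; rewrite fps_coefD fps_coef1 fps_coefXM.
  by case: n => [|n]; rewrite /f /fps_map rmorph1 ?addr0 ?add0r.
have E : fps_comp f (1 - a) = 1 + (1 - a) * fps_comp f (1 - a).
  by rewrite {1}fE fps_compD fps_comp1 fps_compXM.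
set g := fps_comp f _ in E *.
by transitivity (g - (1 - a) * g); [ring | rewrite {1}E; ring].
Qed.
End Inverse.

(** * Operators on functions of a real index *)

Section OperatorAction.
Variable R : realType.
Implicit Types (P Q : opPoly R) (q : {poly R}) (V W : R -> R) (s r x y : R).
Implicit Type T : (R -> R) -> R -> R.

Definition translate r V : R -> R := fun s => V (s + r).

Record lin_shift_inv T : Prop := LinShiftInv {
  lsi_lin : forall x V W, T (fun s => x * V s + W s) = fun s => x * T V s + T W s;
  lsi_shift : forall r V, T (translate r V) = translate r (T V) }.

Lemma lsi_delta : lin_shift_inv (@delta_op R).
Proof.
split=> [x V W|r V]; apply/funext => s; rewrite /delta_op /translate; first by ring.
by rewrite -!addrA ![r + _]addrC.
Qed.

Lemma lsi_mu : lin_shift_inv (@mu_op R).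
Proof.
split=> [x V W|r V]; apply/funext => s; rewrite /mu_op /translate; first by ring.
by rewrite -!addrA ![r + _]addrC.
Qed.

Lemma lsi_iter T k : lin_shift_inv T -> lin_shift_inv (iter k T).
Proof.
move=> [Tl Ts]; elim: k => [|k [IHl IHs]]; split=> //= [x V W|r V].
  by rewrite IHl Tl.
by rewrite IHs Ts.
Qed.

Definition mu_poly_op q V : R -> R :=
  fun s => \sum_(a < size q) q`_a * iter a (@mu_op R) V s.

Lemma mu_poly_op_wide m q V s : (size q <= m)%N ->
  mu_poly_op q V s = \sum_(a < m) q`_a * iter a (@mu_op R) V s.
Proof.
move=> qm; rewrite /mu_poly_op (big_ord_widen m (fun a => q`_a * iter a (@mu_op R) V s)) //.
rewrite big_mkcond; apply: eq_bigr => a _; case: ifPn => //.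
by rewrite -leqNgt => ?; rewrite nth_default ?mul0r.
Qed.

Lemma mu_poly_opD q1 q2 V s :
  mu_poly_op (q1 + q2) V s = mu_poly_op q1 V s + mu_poly_op q2 V s.
Proof.
set m := maxn (size q1) (size q2).
rewrite (@mu_poly_op_wide m (q1 + q2)) ?size_polyD // (@mu_poly_op_wide m q1) ?leq_maxl //.
rewrite (@mu_poly_op_wide m q2) ?leq_maxr //.
by rewrite -big_split; apply: eq_bigr => a _; rewrite coefD mulrDl.
Qed.

Lemma mu_poly_op0 V s : mu_poly_op 0 V s = 0.
Proof. by rewrite /mu_poly_op size_poly0 big_ord0. Qed.

Lemma mu_poly_opC x V s : mu_poly_op x%:P V s = x * V s.
Proof.
by rewrite (@mu_poly_op_wide 1) ?size_polyC ?leq_b1 // big_ord1 coefC.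
Qed.

Lemma mu_poly_opCM x q V s : mu_poly_op (x%:P * q) V s = x * mu_poly_op q V s.
Proof.
rewrite (@mu_poly_op_wide (size q)); last by rewrite mul_polyC size_scale_leq.
rewrite /mu_poly_op mulr_sumr; apply: eq_bigr => a _.
by rewrite coefCM mulrA.
Qed.

Lemma mu_poly_opXM q V s : mu_poly_op ('X * q) V s = mu_poly_op q (mu_op V) s.
Proof.
rewrite (@mu_poly_op_wide (size q).+1).
  rewrite big_ord_recl coefXM mul0r add0r; apply: eq_bigr => a _.
  by rewrite coefXM /= -iterSr.
by rewrite (leq_trans (size_polyMleq _ _)) // size_polyX.
Qed.

Lemma lsi_mu_poly_op q : lin_shift_inv (mu_poly_op q).
Proof.
split=> [x V W|r V]; apply/funext => s; rewrite /mu_poly_op /translate.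
  rewrite mulr_sumr -big_split; apply: eq_bigr => a _.
  by rewrite (lsi_lin (lsi_iter a lsi_mu)) /=; ring.
by apply: eq_bigr => a _; rewrite (lsi_shift (lsi_iter a lsi_mu)).
Qed.

Lemma apply_opE P V s :
  apply_op P V s = \sum_(b < size P) mu_poly_op P`_b (iter b (@delta_op R) V) s.
Proof. by []. Qed.

Lemma apply_op_wide m P V s : (size P <= m)%N ->
  apply_op P V s = \sum_(b < m) mu_poly_op P`_b (iter b (@delta_op R) V) s.
Proof.
move=> Pm; rewrite apply_opE.
rewrite (big_ord_widen m (fun b => mu_poly_op P`_b (iter b (@delta_op R) V) s)) //.
rewrite big_mkcond; apply: eq_bigr => a _; case: ifPn => //.
by rewrite -leqNgt => ?; rewrite nth_default ?mu_poly_op0.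
Qed.

Lemma apply_opD P Q V s : apply_op (P + Q) V s = apply_op P V s + apply_op Q V s.
Proof.
set m := maxn (size P) (size Q).
rewrite (@apply_op_wide m (P + Q)) ?size_polyD // (@apply_op_wide m P) ?leq_maxl //.
rewrite (@apply_op_wide m Q) ?leq_maxr //.
by rewrite -big_split; apply: eq_bigr => a _; rewrite coefD mu_poly_opD.
Qed.

Lemma apply_op0 V s : apply_op 0 V s = 0.
Proof. by rewrite apply_opE size_poly0 big_ord0. Qed.

Lemma apply_op_polyC q V s : apply_op (q%:P : opPoly R) V s = mu_poly_op q V s.
Proof.
by rewrite (@apply_op_wide 1) ?size_polyC ?leq_b1 // big_ord1 coefC.
Qed.

Lemma apply_opXM P V s : apply_op ('X * P : opPoly R) V s = apply_op P (delta_op V) s.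
Proof.
rewrite (@apply_op_wide (size P).+1).
  rewrite big_ord_recl coefXM mu_poly_op0 add0r; apply: eq_bigr => a _.
  by rewrite coefXM /= -iterSr.
by rewrite (leq_trans (size_polyMleq _ _)) // size_polyX.
Qed.

Lemma lsi_apply_op P : lin_shift_inv (apply_op P).
Proof.
split=> [x V W|r V]; apply/funext => s; rewrite apply_opE /translate.
  rewrite !apply_opE mulr_sumr -big_split; apply: eq_bigr => a _.
  by rewrite (lsi_lin (lsi_iter a lsi_delta)) (lsi_lin (lsi_mu_poly_op _)).
rewrite apply_opE; apply: eq_bigr => a _.
by rewrite (lsi_shift (lsi_iter a lsi_delta)) (lsi_shift (lsi_mu_poly_op _)).
Qed.

(** [delta] is a combination of translates, so it commutes with every linear translation-invariant
    operator. This, and its analogue for [mu], lets commuting symbols represent the operators. *)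
Lemma lsi_deltaC T V : lin_shift_inv T -> delta_op (T V) = T (delta_op V).
Proof.
move=> [Tl Ts]; have -> : delta_op V = fun s => -1 * translate (- 2^-1) V s + translate 2^-1 V s.
  by apply/funext => s; rewrite /delta_op /translate; ring.
by rewrite Tl !Ts; apply/funext => s; rewrite /delta_op /translate; ring.
Qed.

Lemma lsi_muC T V : lin_shift_inv T -> mu_op (T V) = T (mu_op V).
Proof.
move=> [Tl Ts].
(* Linearity is given for [x * V + W], so a bare multiple requires the image of 0. *)
have T0 : T (fun=> 0) = fun=> 0.
  have := Tl (-1) (fun=> 0) (fun=> 0).
  rewrite (_ : (fun _ : R => -1 * 0 + 0) = fun=> 0); last by apply/funext => s; ring.
  by move=> E; apply/funext => s; have := congr1 (@^~ s) E; rewrite /= mulN1r addNr.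
have -> : mu_op V = fun s => 2^-1 * translate (- 2^-1) V s + (2^-1 * translate 2^-1 V s + 0).
  by apply/funext => s; rewrite /mu_op /translate; ring.
by rewrite !Tl !Ts T0; apply/funext => s; rewrite /mu_op /translate; ring.
Qed.

Lemma size_polyC_mul_leq (B : nzRingType) (z : B) (p : {poly B}) :
  (size (z%:P * p)%R <= size p)%N.
Proof. by rewrite mul_polyC size_scale_leq. Qed.

Lemma apply_opCM x P V s : apply_op (opC x * P) V s = x * apply_op P V s.
Proof.
rewrite (@apply_op_wide (size P)) ?size_polyC_mul_leq // apply_opE mulr_sumr.
by apply: eq_bigr => b _; rewrite coefCM mu_poly_opCM.
Qed.

Lemma apply_op_muM P V : apply_op (mu_sym R * P) V = mu_op (apply_op P V).
Proof.
rewrite (lsi_muC _ (lsi_apply_op P)); apply/funext => t.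
rewrite (@apply_op_wide (size P)) ?size_polyC_mul_leq // apply_opE.
apply: eq_bigr => a _; rewrite coefCM mu_poly_opXM.
by rewrite (lsi_muC _ (lsi_iter a lsi_delta)).
Qed.

Lemma apply_op_deltaM P V : apply_op (delta_sym R * P) V = delta_op (apply_op P V).
Proof. by rewrite (lsi_deltaC _ (lsi_apply_op P)); apply/funext => t; exact: apply_opXM. Qed.

Lemma mu_poly_opM q P V :
  apply_op (q%:P * P : opPoly R) V = mu_poly_op q (apply_op P V).
Proof.
elim/poly_ind: q V P => [|q x IH] V P; apply/funext => s.
  by rewrite mul0r apply_op0 mu_poly_op0.
rewrite polyCD mulrDl apply_opD mu_poly_opD polyCM -mulrA IH apply_op_muM.
by rewrite [q * 'X]mulrC mu_poly_opXM mu_poly_opC apply_opCM.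
Qed.

(** Products of symbols act as compositions: induction on the degree in [delta], each symbol being
    moved past the other operator by commutation. *)
Lemma apply_opM P Q V : apply_op (P * Q) V = apply_op P (apply_op Q V).
Proof.
elim/poly_ind: P V Q => [|P q IH] V Q; apply/funext => s.
  by rewrite mul0r !apply_op0.
rewrite mulrDl !apply_opD mu_poly_opM apply_op_polyC -mulrA IH apply_op_deltaM.
by rewrite [P * _]mulrC apply_opXM.
Qed.

Lemma apply_op1 V : apply_op 1 V = V.
Proof. by apply/funext => s; rewrite apply_op_polyC mu_poly_opC mul1r. Qed.

Lemma apply_op_mu V : apply_op (mu_sym R) V = mu_op V.
Proof. by rewrite -[mu_sym R]mulr1 apply_op_muM apply_op1. Qed.

Lemma apply_op_delta V : apply_op (delta_sym R) V = delta_op V.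
Proof. by rewrite -[delta_sym R]mulr1 apply_op_deltaM apply_op1. Qed.

Lemma apply_op_sum (I : Type) (l : seq I) (p : pred I) (F : I -> opPoly R) V s :
  apply_op (\sum_(i <- l | p i) F i) V s = \sum_(i <- l | p i) apply_op (F i) V s.
Proof.
elim/big_rec2: _ => [|i x y _ <-]; first by rewrite apply_op0.
by rewrite apply_opD.
Qed.

(* [mu] and [delta] are independent symbols of [opPoly]; the relation
   [mu^2 = 1 + delta^2 / 4] holds only for the operators, so identities are
   proved modulo the polynomials that act as zero. *)
Definition null_op P := forall V s, apply_op P V s = 0.

Lemma null_op0 : null_op 0. Proof. by move=> V s; rewrite apply_op0. Qed.
Lemma null_opD P Q : null_op P -> null_op Q -> null_op (P + Q).
Proof. by move=> P0 Q0 V s; rewrite apply_opD P0 Q0 addr0. Qed.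
Lemma null_opM P Q : null_op Q -> null_op (P * Q).
Proof. by move=> Q0 V s; rewrite mulrC apply_opM. Qed.

Lemma half_step s : s + 2^-1 + 2^-1 = s + 1. Proof. by field. Qed.
Lemma half_stepN s : s - 2^-1 - 2^-1 = s - 1. Proof. by field. Qed.

Lemma null_op_mu_delta :
  null_op (mu_sym R ^+ 2 - 1 - opC 2^-1 ^+ 2 * delta_sym R ^+ 2).
Proof.
move=> V s; have -> : mu_sym R ^+ 2 - 1 - opC 2^-1 ^+ 2 * delta_sym R ^+ 2 =
   mu_sym R * mu_sym R + (opC (-1) * 1 + opC (- 2^-1) * (opC 2^-1 * (delta_sym R * delta_sym R))).
  by rewrite /opC !polyCN; ring.
rewrite !apply_opD !apply_opCM apply_op1 apply_op_muM apply_op_deltaM.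
rewrite apply_op_mu apply_op_delta /mu_op /delta_op.
by rewrite ?half_step ?half_stepN ?addrK ?subrK; field.
Qed.

(** A finite list of weights and offsets. Integer offsets record that all half steps have cancelled;
    repeated offsets are allowed, which keeps sums and products simple. *)
Definition stencil n P := exists2 l : seq (R * int),
  all (fun u => `|u.2| <= n)%N l &
  forall V s, apply_op P V s = \sum_(u <- l) u.1 * V (s + u.2%:~R).

Lemma stencil0 n : stencil n 0.
Proof. by exists [::] => // V s; rewrite apply_op0 big_nil. Qed.

Lemma stencilD n P Q : stencil n P -> stencil n Q -> stencil n (P + Q).
Proof.
move=> [l ln lE] [k kn kE]; exists (l ++ k) => [|V s]; first by rewrite all_cat ln.
by rewrite big_cat apply_opD lE kE.
Qed.

Lemma stencilM m n P Q : stencil m P -> stencil n Q -> stencil (m + n) (P * Q).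
Proof.
move=> [l lm lE] [k kn kE].
exists [seq (u.1 * v.1, u.2 + v.2) | u <- l, v <- k].
  apply/allP => _ /allpairsP[[x y] /= [xl yk ->]] /=.
  move/allP: lm => /(_ _ xl); move/allP: kn => /(_ _ yk) => yn xm.
  by move: (leq_add xm yn); apply: leq_trans; rewrite -lez_nat PoszD !abszE ler_normD.
move=> V s; rewrite apply_opM lE big_allpairs_dep /=; apply: eq_bigr => x _.
rewrite kE mulr_sumr; apply: eq_bigr => y _ /=.
by rewrite mulrA rmorphD addrA.
Qed.

Lemma stencilC x : stencil 0 (opC x).
Proof.
exists [:: (x, 0%Z)] => // V s.
by rewrite big_seq1 /= addr0 -[opC x]mulr1 apply_opCM apply_op1.
Qed.

Lemma stencil_leq m n P : (m <= n)%N -> stencil m P -> stencil n P.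
Proof.
move=> mn [l lm lE]; exists l => //; apply: sub_all lm => x /= xm.
exact: leq_trans mn.
Qed.

(** With [E] the unit shift, [mu delta = (E - E^-1) / 2]: the half steps combine into whole ones. *)
Lemma stencil_mu_delta : stencil 1 (mu_sym R * delta_sym R).
Proof.
exists [:: (2^-1, 1%Z); (- 2^-1, (-1)%Z)] => // V s.
rewrite apply_op_muM apply_op_delta !big_cons big_nil /= /mu_op /delta_op.
rewrite ?half_step ?half_stepN ?addrK ?subrK ?mulrN1z ?addr0.
by rewrite ?(mulr1z 1); field.
Qed.

(** With [E] the unit shift, [delta^2 = E - 2 + E^-1]. *)
Lemma stencil_delta_sqr : stencil 1 (delta_sym R * delta_sym R).
Proof.
exists [:: (1, 1%Z); (-2, 0%Z); (1, (-1)%Z)] => // V s.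
rewrite apply_op_deltaM apply_op_delta !big_cons big_nil /= /delta_op.
rewrite ?half_step ?half_stepN ?addrK ?subrK ?mulrN1z ?addr0.
by rewrite ?(mulr1z 1); field.
Qed.

End OperatorAction.

(** * The closed form *)

HB.instance Definition _ (R : realType) :=
  GRing.RMorphism.copy (@opC R) (polyC \o polyC : R -> opPoly R).

(** Here [e] is one half, [t] is theta and [x] is gamma. The right side carries the factor
    [m^2 - 1 - d^2 / 4], which acts as zero once [m] and [d] are the operators. *)
Lemma radicand_identity (B : comNzRingType) (e t m d x : B) : e * 2 = 1 ->
  (1 + (e ^+ 2 * d ^+ 2 - e * t * m * d) * x) ^+ 2 -
  (1 + (e * d ^+ 2 * x - t * m * d * x + e ^+ 2 * (t ^+ 2 - 1) * d ^+ 2 * x ^+ 2)) -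
  (e * (m - e * t * d) * d * x) ^+ 2 =
  e ^+ 2 * (t ^+ 2 - 1) * d ^+ 2 * (m ^+ 2 - 1 - e ^+ 2 * d ^+ 2) * x ^+ 2.
Proof.
move=> e2; apply/eqP; rewrite -subr_eq0; apply/eqP.
(* The two sides differ by a multiple of [2 e - 1]. *)
transitivity ((e * 2 - 1) * (e * d ^+ 2 * x - t * m * d * x)); first by ring.
by rewrite e2 subrr mul0r.
Qed.

Section ClosedFormSeries.
Variables (R : realType) (theta : R).
Local Notation A := (opPoly R).
Local Notation mu := (mu_sym R).
Local Notation delta := (delta_sym R).

Definition num_series : fps A := fps_of_poly (cf_num theta).
Definition rad_series : fps A := fps_of_poly (cf_rad theta).
Definition rsqrt_series : fps A := fps_comp (fps_map (@opC R) (rsqrt1p_coef R)) rad_series.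
Definition sinh_series : fps A := num_series * rsqrt_series.
Definition asinh_series : fps A := fps_comp (fps_map (@opC R) (asinh_coef R)) sinh_series.
(** The hyperbolic cosine of [asinh_series], written as [(1 + z^2)] times the derivative of asinh at
    [z = sinh_series]. *)
Definition cosh_series : fps A := (1 + sinh_series ^+ 2) *
  fps_comp (fps_deriv (fps_map (@opC R) (asinh_coef R))) sinh_series.
(** [1 + den_series] is the factor of sinh in the coupling condition for exponential fields; modulo
    null operators its square is [1 + rad_series + num_series ^+ 2]. *)
Definition den_series : fps A := fps_of_poly
  ((opC 2^-1 ^+ 2 * delta ^+ 2 - opC 2^-1 * opC theta * mu * delta) *: 'X).

Lemma holistic_coefE c H n :
  holistic_coef c H theta n = opC (- (2 * c / H)) * asinh_series n.
Proof. by []. Qed.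

Lemma num_series0 : num_series 0%N = 0.
Proof. by rewrite /num_series /fps_of_poly /cf_num coefZ coefX mulr0. Qed.

Lemma rad_series0 : rad_series 0%N = 0.
Proof.
by rewrite /rad_series /fps_of_poly /cf_rad !(coefD, coefN, coefZ, coefX, coefXn) /= !mulr0 subrr addr0.
Qed.

Lemma sinh_series0 : sinh_series 0%N = 0.
Proof. by rewrite /sinh_series fps_coef0M num_series0 mul0r. Qed.

Lemma asinh_series0 : asinh_series 0%N = 0.
Proof. exact: asinh_comp_coef0. Qed.

Lemma rsqrt_series_sqr : rsqrt_series ^+ 2 * (1 + rad_series) = 1.
Proof. exact: rsqrt1p_comp_sqr rad_series0. Qed.

Lemma cosh_series_sqr : cosh_series ^+ 2 = 1 + sinh_series ^+ 2.
Proof.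
have := asinh_rho_sqr (@opC R) sinh_series0; rewrite /cosh_series.
set r := fps_comp _ _ => E.
transitivity ((1 + sinh_series ^+ 2) * (r ^+ 2 * (1 + sinh_series ^+ 2))); first by ring.
by rewrite E mulr1.
Qed.

Lemma closed_form_square : exists B : A,
  (1 + den_series) ^+ 2 - (1 + rad_series) - num_series ^+ 2 =
  fps_of_poly ((B * (mu ^+ 2 - 1 - opC 2^-1 ^+ 2 * delta ^+ 2)) *: 'X^2).
Proof.
exists (opC 2^-1 ^+ 2 * (opC theta ^+ 2 - 1) * delta ^+ 2).
rewrite /den_series /rad_series /num_series /cf_num /cf_rad.
rewrite -!(rmorph1 (@fps_of_poly A)) -!rmorphD -!rmorphXn -!rmorphB; congr fps_of_poly.
have -> : 4^-1 = 2^-1 ^+ 2 :> R by field.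
rewrite !(rmorphM, rmorphB, rmorphXn, rmorph1) /=.
set e := opC 2^-1; set t := opC theta; rewrite -!mul_polyC.
have e2 : e * 2 = 1 by rewrite -(rmorph_nat (@opC R)) -rmorphM mulVf ?rmorph1 ?pnatr_eq0.
have E2 : e%:P * 2 = 1 :> {poly A} by rewrite -(rmorph_nat (@polyC A)) -rmorphM e2 rmorph1.
rewrite !(polyCM, polyCB, polyC_exp).
exact: radicand_identity.
Qed.

Lemma rho_series0 :
  fps_comp (fps_deriv (fps_map (@opC R) (asinh_coef R))) sinh_series 0%N = 1.
Proof. exact: asinh_rho0. Qed.

(** Both terms have the same square modulo null operators. The difference of squares factors, and
    the sum of the terms has constant term 2, so it can be cancelled modulo the ideal. *)
Lemma null_op_cosh_series n :
  null_op ((rsqrt_series * (1 + den_series) - cosh_series) n).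
Proof.
pose s := rsqrt_series * (1 + den_series) + cosh_series.
apply: (@ideal_cancel R A (@opC R) (@null_op R) _ s 2) => //.
- exact: null_op0.
- exact: null_opD.
- exact: null_opM.
- rewrite /s /cosh_series fps_coefD !fps_coef0M !fps_coefD rho_series0 !expr2 fps_coef0M.
  rewrite sinh_series0 /rsqrt_series fps_comp_coef0 /fps_map.
  rewrite /rsqrt1p_coef big_ord0 fact0 divr1 fps_coef1.
  rewrite /den_series /fps_of_poly coefZ coefX mulr0 mulr0 !addr0 rmorph1 !mulr1.
  by rewrite rmorph_nat.
move=> k; have [B BE] := closed_form_square.
have -> : (rsqrt_series * (1 + den_series) - cosh_series) * s =
    rsqrt_series ^+ 2 * fps_of_poly
      ((B * (mu ^+ 2 - 1 - opC 2^-1 ^+ 2 * delta ^+ 2)) *: 'X^2).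
  rewrite -BE /s.
  transitivity (rsqrt_series ^+ 2 * (1 + den_series) ^+ 2 - cosh_series ^+ 2).
    by ring.
  rewrite cosh_series_sqr /sinh_series.
  transitivity (rsqrt_series ^+ 2 * (1 + den_series) ^+ 2
    - (rsqrt_series ^+ 2 * (1 + rad_series) + (num_series * rsqrt_series) ^+ 2)).
    by rewrite rsqrt_series_sqr.
  by ring.
rewrite fps_coefM; elim/big_rec: _ => [|i P _ IH]; first exact: null_op0.
apply: null_opD => //; rewrite /fps_of_poly coefZ [B * _ * _]mulrAC mulrA.
by apply: null_opM; exact: null_op_mu_delta.
Qed.

End ClosedFormSeries.

(** * Both gradings of the closed form at once *)

Section ClosedFormFiltration.
Variables (R : realType) (theta : R).
Local Notation A := (opPoly R).
Variable F : nat -> A -> Prop.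
Hypothesis FF : filtration (@opC R) F.
Hypothesis F_mu_delta : F 1%N (mu_sym R * delta_sym R).
(** The square of [delta] occurs in the radicand with [gamma] and with [gamma^2], hence must lie in
    level 1 and in level 2. *)
Hypothesis F_delta_sqr1 : F 1%N (delta_sym R * delta_sym R).
Hypothesis F_delta_sqr2 : F 2%N (delta_sym R * delta_sym R).

Lemma num_series_filtered : fps_filtered F (num_series theta).
Proof.
move=> n; rewrite /num_series /fps_of_poly /cf_num coefZ coefX.
case: eqP => [->|_]; last by rewrite mulr0; exact: (filtration0 FF).
rewrite mulr1.
have -> : opC 2^-1 * (mu_sym R - opC (2^-1 * theta) * delta_sym R) * delta_sym R =
  opC 2^-1 * (mu_sym R * delta_sym R) +
  opC (2^-1 * - (2^-1 * theta)) * (delta_sym R * delta_sym R).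
  by rewrite !(rmorphM, rmorphN) /=; ring.
by apply: (filtrationD FF); apply: (filteredC FF).
Qed.

Lemma rad_series_filtered : fps_filtered F (rad_series theta).
Proof.
move=> n; rewrite /rad_series /fps_of_poly /cf_rad !(coefD, coefN, coefZ, coefX, coefXn).
case: n => [|[|[|n]]] /=; rewrite ?mulr0 ?mulr1 ?subr0 ?addr0 ?add0r ?subr0; try exact: (filtration0 FF).
- have -> : opC 2^-1 * delta_sym R ^+ 2 - opC theta * mu_sym R * delta_sym R =
    opC 2^-1 * (delta_sym R * delta_sym R) + opC (- theta) * (mu_sym R * delta_sym R).
    by rewrite !rmorphN /=; ring.
  by apply: (filtrationD FF); apply: (filteredC FF).
- by rewrite expr2; apply: (filteredC FF).
Qed.

Lemma rsqrt_series_filtered : fps_filtered F (rsqrt_series theta).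
Proof. exact: (fps_filtered_comp FF _ rad_series_filtered). Qed.

Lemma sinh_series_filtered : fps_filtered F (sinh_series theta).
Proof.
exact: (fps_filteredM FF num_series_filtered rsqrt_series_filtered).
Qed.

Lemma asinh_series_filtered : fps_filtered F (asinh_series theta).
Proof. exact: (fps_filtered_comp FF _ sinh_series_filtered). Qed.
End ClosedFormFiltration.

(** * Action of local operators on functions of an integer index *)

Section GridAction.
Variables (R : realType).
Implicit Types (P Q : opPoly R) (U W : int -> R) (j k : int).

Lemma stencil_filtration : filtration (@opC R) (@stencil R).
Proof.
split; [exact: stencil0 | exact: stencilD | exact: stencilM | exact: stencilC].
Qed.

Definition grid_local P := exists n, stencil n P.

Lemma asinh_series_stencil (theta : R) : fps_filtered (@stencil R) (asinh_series theta).
Proof.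
apply: (asinh_series_filtered theta stencil_filtration).
- exact: stencil_mu_delta.
- exact: stencil_delta_sqr.
- by apply: (@stencil_leq _ 1) => //; exact: stencil_delta_sqr.
Qed.

Lemma holistic_coef_stencil (c H theta : R) n : stencil n (holistic_coef c H theta n).
Proof.
rewrite holistic_coefE; apply: (filteredC stencil_filtration).
exact: asinh_series_stencil.
Qed.

(* [delta] and [mu] act on functions of a real index, so a grid function is
   first extended to be constant between grid points; for an operator with a
   stencil the choice of the extension is irrelevant. *)
Definition grid_op P U : int -> R :=
  fun j => apply_op P (fun s => U (Num.floor s)) j%:~R.

Lemma grid_opE P (V : R -> R) j : grid_local P ->
  apply_op P V j%:~R = grid_op P (fun i : int => V i%:~R) j.
Proof.
move=> [n [l _ lE]]; rewrite /grid_op !lE; apply: eq_bigr => u _.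
by rewrite -!rmorphD /= intrKfloor.
Qed.

Lemma grid_op_lin P x U W j :
  grid_op P (fun i => x * U i + W i) j = x * grid_op P U j + grid_op P W j.
Proof.
rewrite /grid_op.
exact: (congr1 (@^~ j%:~R) (lsi_lin (lsi_apply_op P) x _ _)).
Qed.

Lemma grid_opD P Q U j : grid_op (P + Q) U j = grid_op P U j + grid_op Q U j.
Proof. exact: apply_opD. Qed.

Lemma grid_opCM x P U j : grid_op (opC x * P) U j = x * grid_op P U j.
Proof. exact: apply_opCM. Qed.

Lemma grid_op0 U j : grid_op 0 U j = 0.
Proof. exact: apply_op0. Qed.

Lemma grid_op_null P U j : null_op P -> grid_op P U j = 0.
Proof. exact. Qed.

Lemma grid_op_sum (I : Type) (l : seq I) (p : pred I) (F : I -> opPoly R) U j :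
  grid_op (\sum_(i <- l | p i) F i) U j = \sum_(i <- l | p i) grid_op (F i) U j.
Proof. exact: apply_op_sum. Qed.

Lemma grid_opM P Q U j : grid_local P -> grid_local Q ->
  grid_op (P * Q) U j = grid_op P (grid_op Q U) j.
Proof.
by move=> Pl Ql; rewrite {1}/grid_op apply_opM grid_opE.
Qed.

Lemma grid_op1 U j : grid_op 1 U j = U j.
Proof. by rewrite /grid_op apply_op1 intrKfloor. Qed.

Lemma grid_op_shift P U j k :
  grid_op P U (j + k) = grid_op P (fun i => U (i + k)) j.
Proof.
rewrite /grid_op rmorphD /=.
rewrite (_ : (fun s : R => U (Num.floor s + k)) =
  translate k%:~R (fun s : R => U (Num.floor s))).
  by rewrite (lsi_shift (lsi_apply_op P)).
by apply/funext => s; rewrite /translate floorDrz ?intrKfloor // intr_int.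
Qed.

Lemma grid_op_periodic N P U : grid_periodic N U -> grid_periodic N (grid_op P U).
Proof.
move=> UN j; rewrite grid_op_shift; congr (grid_op _ _ _); exact/funext.
Qed.

(** The shifts [E] and [E^-1] as [1 + mu delta + delta^2 / 2] and [1 - mu delta + delta^2 / 2]; they
    express neighbouring elements inside the operator ring. *)
Definition next_sym : opPoly R :=
  1 + mu_sym R * delta_sym R + opC 2^-1 * (delta_sym R * delta_sym R).
Definition prev_sym : opPoly R :=
  1 + opC (-1) * (mu_sym R * delta_sym R) + opC 2^-1 * (delta_sym R * delta_sym R).

Lemma apply_op_next V s : apply_op next_sym V s = V (s + 1).
Proof.
rewrite !apply_opD apply_opCM apply_op1 apply_op_muM apply_op_deltaM !apply_op_delta.
by rewrite /mu_op /delta_op half_step half_stepN addrK subrK; field.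
Qed.
Lemma apply_op_prev V s : apply_op prev_sym V s = V (s - 1).
Proof.
rewrite !apply_opD !apply_opCM apply_op1 apply_op_muM apply_op_deltaM !apply_op_delta.
by rewrite /mu_op /delta_op half_step half_stepN addrK subrK; field.
Qed.

Lemma grid_op_next P U j : grid_op (next_sym * P) U j = grid_op P U (j + 1).
Proof. by rewrite /grid_op apply_opM apply_op_next rmorphD. Qed.
Lemma grid_op_prev P U j : grid_op (prev_sym * P) U j = grid_op P U (j - 1).
Proof. by rewrite /grid_op apply_opM apply_op_prev rmorphB. Qed.

End GridAction.

(** * Equivalent PDE and stencil *)

Section Symbol.
Variables (R : realType) (m d : fps R).
Hypothesis d0 : d 0%N = 0.
Implicit Types (P Q : opPoly R) (f g z : fps (opPoly R)).

(** The substitution [subst_op] as a composite of evaluation morphisms, so that it is a ring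
    morphism by construction. *)
Definition symbol : opPoly R -> fps R :=
  horner_eval d \o map_poly (horner_eval m \o map_poly (@fpsC R)).
HB.instance Definition _ := GRing.RMorphism.copy symbol
  (horner_eval d \o map_poly (horner_eval m \o map_poly (@fpsC R))).

Lemma symbolE P q : subst_op P m d q = symbol P q.
Proof.
rewrite /symbol /= /horner_eval /map_poly horner_poly fps_coef_sum.
apply: eq_bigr => b _; rewrite /= /horner_eval /map_poly. rewrite horner_poly mulr_suml fps_coef_sum.
by apply: eq_bigr => a _; rewrite -mulrA fps_coefCM fps_mulE !fps_expE.
Qed.

Lemma symbol_polyC (q : {poly R}) : symbol q%:P = (map_poly (@fpsC R) q).[m].
Proof. by rewrite /symbol [LHS]/= map_polyC /horner_eval hornerC. Qed.

Lemma symbolC (x : R) : symbol (opC x) = fpsC x.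
Proof. by rewrite symbol_polyC map_polyC hornerC. Qed.

Lemma symbol_mu : symbol (mu_sym R) = m.
Proof. by rewrite symbol_polyC map_polyX hornerX. Qed.

Lemma symbol_delta : symbol (delta_sym R) = d.
Proof. by rewrite /symbol [LHS]/= map_polyX /horner_eval hornerX. Qed.

Definition symbol_order n P := forall q, (q < n)%N -> symbol P q = 0.

Lemma symbol_order0 n : symbol_order n 0.
Proof. by move=> q _; rewrite rmorph0. Qed.

Lemma symbol_orderD n P Q :
  symbol_order n P -> symbol_order n Q -> symbol_order n (P + Q).
Proof. by move=> Pn Qn q qn; rewrite rmorphD /= fps_coefD Pn ?Qn ?addr0. Qed.

Lemma symbol_orderM k n P Q :
  symbol_order k P -> symbol_order n Q -> symbol_order (k + n)%N (P * Q).
Proof.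
move=> Pk Qn q qkn; rewrite rmorphM /= fps_coefM big1 // => i _.
have [ik|ki] := ltnP i k; first by rewrite Pk ?mul0r.
rewrite Qn ?mulr0 // -(ltn_add2l k) (leq_ltn_trans _ qkn) //.
by rewrite -[leqRHS](subnKC (n := q) (m := i)) ?leq_add2r // -ltnS.
Qed.

Lemma symbol_orderC x : symbol_order 0 (opC x). Proof. by []. Qed.

Lemma symbol_order_mu_delta : symbol_order 1 (mu_sym R * delta_sym R).
Proof.
case=> // _; rewrite rmorphM /= symbol_mu symbol_delta fps_coef0M.
by rewrite [d 0%N]d0 mulr0.
Qed.

Lemma symbol_order_delta : symbol_order 1 (delta_sym R).
Proof. by case=> // _; rewrite symbol_delta. Qed.

Lemma symbol_order_delta_sqr2 : symbol_order 2 (delta_sym R * delta_sym R).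
Proof. exact: (symbol_orderM symbol_order_delta symbol_order_delta). Qed.

Lemma symbol_order_delta_sqr1 : symbol_order 1 (delta_sym R * delta_sym R).
Proof. by move=> q q1; apply: symbol_order_delta_sqr2; rewrite ltnW. Qed.

Lemma symbol_filtration : filtration (@opC R) symbol_order.
Proof.
split; [exact: symbol_order0 | exact: symbol_orderD | exact: symbol_orderM |].
exact: symbol_orderC.
Qed.

Local Notation filtered := (fps_filtered symbol_order).

(* Value at [gamma = 1] of the series whose [gamma ^ n] coefficient has symbol
   [O(dx ^ n)]: only the coefficients with [n <= q] contribute to [dx ^ q]. *)
Definition full_coupling f : fps R := fun q => \sum_(n < q.+1) symbol (f n) q.

Lemma full_coupling_wide k f q : filtered f -> (q < k)%N ->
  full_coupling f q = \sum_(n < k) symbol (f n) q.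
Proof.
move=> Ff qk; rewrite /full_coupling (big_ord_widen k (fun n => symbol (f n) q)) //.
rewrite big_mkcond; apply: eq_bigr => n _; case: ifPn => //.
by rewrite -leqNgt => qn; rewrite Ff.
Qed.

Lemma full_couplingM f g : filtered f -> filtered g ->
  full_coupling (f * g) = full_coupling f * full_coupling g.
Proof.
move=> Ff Fg; apply/funext => q; rewrite fps_coefM.
(* [p i] and [r i] collect, as polynomials in gamma, the coefficients of [dx^i]; full coupling is
   evaluation at 1, which is multiplicative. *)
pose p i : {poly R} := \poly_(n < q.+1) symbol (f n) i.
pose r i : {poly R} := \poly_(n < q.+1) symbol (g n) i.
transitivity (\sum_(i < q.+1) (p i).[1] * (r (q - i)%N).[1]); last first.
  apply: eq_bigr => i _; rewrite !(full_coupling_wide (k := q.+1)) // ?ltnS ?leq_subr //.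
  rewrite /p /r !horner_poly.
  by congr (_ * _); apply: eq_bigr => n _; rewrite expr1n mulr1.
rewrite /full_coupling.
transitivity (\sum_(n < q.+1) \sum_(i < q.+1) (p i * r (q - i)%N)`_n).
  apply: eq_bigr => n _; rewrite fps_coefM rmorph_sum fps_coef_sum.
  under eq_bigr do rewrite rmorphM fps_coefM.
  rewrite exchange_big; apply: eq_bigr => i _; rewrite coefM; apply: eq_bigr => k _.
  have kq : (k < q.+1)%N by rewrite (leq_trans (ltn_ord k)).
  by rewrite !coef_poly kq (leq_ltn_trans (leq_subr _ _) (ltn_ord n)).
rewrite exchange_big; apply: eq_bigr => i _; rewrite -hornerM.
rewrite (@horner_coef_wide _ q.+1).
  by apply: eq_bigr => n _; rewrite expr1n mulr1.
(* By the filtration [p i] has degree at most [i] and [r (q - i)] at most [q - i], so nothing beyond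
   [gamma^q] is lost. *)
apply/leq_sizeP => n qn; rewrite coefM big1 // => k _.
rewrite !coef_poly; case: ifP => // _; last by rewrite mul0r.
case: ifP => // _; last by rewrite mulr0.
have [ik|ki] := ltnP i k; first by rewrite Ff ?mul0r.
rewrite Fg ?mulr0 //; have := ltn_ord i; lia.
Qed.

Lemma full_couplingX f k : filtered f ->
  full_coupling (f ^+ k) = full_coupling f ^+ k.
Proof.
move=> Ff; elim: k => [|k IH].
  rewrite !expr0; apply/funext => q; rewrite /full_coupling big_ord_recl fps_coef1 rmorph1.
  by rewrite big1 ?addr0 // => i _; rewrite fps_coef1 rmorph0.
rewrite !exprS full_couplingM ?IH //.
exact: (fps_filteredX symbol_filtration).
Qed.

Lemma full_coupling_coef0 f : full_coupling f 0%N = symbol (f 0%N) 0%N.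
Proof. by rewrite /full_coupling big_ord1. Qed.

Lemma full_coupling_comp (u : fps R) z : z 0%N = 0 -> filtered z ->
  full_coupling (fps_comp (fps_map (@opC R) u) z) = fps_comp u (full_coupling z).
Proof.
move=> z0 Fz; apply/funext => q.
have Z0 : full_coupling z 0%N = 0 by rewrite full_coupling_coef0 z0 rmorph0.
rewrite (fps_comp_coef _ Z0 (ltnSn q)) fps_coef_sum /full_coupling.
transitivity (\sum_(n < q.+1) \sum_(k < q.+1) u k * symbol ((z ^+ k) n) q).
  apply: eq_bigr => n _; rewrite (fps_comp_coef _ z0 (ltn_ord n)) fps_coef_sum.
  rewrite rmorph_sum fps_coef_sum; apply: eq_bigr => k _.
  by rewrite fps_coefCM rmorphM /= symbolC fps_coefCM.
rewrite exchange_big; apply: eq_bigr => k _; rewrite fps_coefCM -full_couplingX //.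
by rewrite mulr_sumr.
Qed.

End Symbol.

(** * Full coupling and the exact wave equation, with [h] half the element length *)

Section Consistency.
Variables (R : realType) (theta h : R).

Definition sinh_fps : fps R := sinh_coef h.
Definition cosh_fps : fps R := cosh_coef h.

Lemma natr_fact_ode (x : R) k : x ^+ k.+1 / k.+1`!%:R *+ k.+1 = x * (x ^+ k / k`!%:R).
Proof.
have n0 : k.+1%:R != 0 :> R by rewrite pnatr_eq0.
have f0 : k`!%:R != 0 :> R by rewrite pnatr_eq0 -lt0n fact_gt0.
by rewrite factS natrM exprS -mulr_natr; field; rewrite f0 nat1r n0.
Qed.

Lemma sinh_fps_deriv : fps_deriv sinh_fps = fpsC h * cosh_fps.
Proof.
apply/funext => k; rewrite fps_coefCM /fps_deriv /sinh_fps /cosh_fps /sinh_coef /cosh_coef /=.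
by case: (odd k); rewrite /= ?mul0rn ?mulr0 // natr_fact_ode.
Qed.

Lemma cosh_fps_deriv : fps_deriv cosh_fps = fpsC h * sinh_fps.
Proof.
apply/funext => k; rewrite fps_coefCM /fps_deriv /sinh_fps /cosh_fps /sinh_coef /cosh_coef /=.
by case: (odd k); rewrite /= ?mul0rn ?mulr0 // natr_fact_ode.
Qed.

Lemma sinh_fps0 : sinh_fps 0%N = 0. Proof. by []. Qed.
Lemma cosh_fps0 : cosh_fps 0%N = 1.
Proof. by rewrite /cosh_fps /cosh_coef /= expr0 fact0 divr1. Qed.

Lemma cosh_fps_sqr : cosh_fps ^+ 2 = 1 + sinh_fps ^+ 2.
Proof.
suff : cosh_fps ^+ 2 - sinh_fps ^+ 2 = 1 by move/eqP; rewrite subr_eq => /eqP.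
rewrite (@fps_deriv_eq0 R R idfun (cosh_fps ^+ 2 - sinh_fps ^+ 2) 1) ?rmorph1 //.
  rewrite fps_derivB !fps_derivXn !expr1 sinh_fps_deriv cosh_fps_deriv; ring.
by rewrite fps_coefB !expr2 !fps_coef0M sinh_fps0 cosh_fps0 mulr0 subr0 mulr1.
Qed.

(** [(w - 1)(w + 1) = 0], and [w + 1] has constant term 2, so it cancels. *)
Lemma fps_sqrt1 (w : fps R) : w ^+ 2 = 1 -> w 0%N = 1 -> w = 1.
Proof.
move=> w2 w0; apply/eqP; rewrite -subr_eq0; apply/eqP/funext => n.
apply: (@ideal_cancel R R idfun (fun x => x = 0) _ (w + 1) 2) => //.
- by move=> x y -> ->; rewrite addr0.
- by move=> x y ->; rewrite mulr0.
- by rewrite fps_coefD w0 fps_coef1.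
- by move=> k; rewrite -subr_sqr w2 expr1n subrr.
Qed.

Let m := cosh_fps.
Let d : fps R := fun k => 2 * sinh_coef h k.
Local Notation full := (full_coupling m d).

Lemma central_diffE : d = fpsC 2 * sinh_fps.
Proof. by apply/funext => k; rewrite fps_coefCM. Qed.

Lemma central_diff0 : d 0%N = 0. Proof. by rewrite central_diffE fps_coefCM mulr0. Qed.

Lemma central_mean_sqr : m ^+ 2 = 1 + fpsC 4^-1 * d ^+ 2.
Proof.
rewrite cosh_fps_sqr central_diffE exprMn -rmorphXn mulrA -rmorphM.
by rewrite (_ : 4^-1 * 2 ^+ 2 = 1 :> R) ?rmorph1 ?mul1r //; field.
Qed.

(** The derivative is [h] times [cosh / sqrt (1 + sinh^2)]; that quotient squares to 1 and has
    constant term 1, so it is 1. *)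
Lemma asinh_sinh_fps : fps_comp (asinh_coef R) sinh_fps = fpsC h * fpsX R.
Proof.
rewrite -[asinh_coef R]/(fps_map idfun (asinh_coef R)).
set a := fps_comp _ _.
have Da : fps_deriv a = fpsC h.
  rewrite /a asinh_comp_deriv //; set r := fps_comp _ _.
  have r2 : r ^+ 2 * (1 + sinh_fps ^+ 2) = 1 := asinh_rho_sqr idfun sinh_fps0.
  have r0 : r 0%N = 1 := asinh_rho0 idfun sinh_fps.
  rewrite sinh_fps_deriv mulrCA (@fps_sqrt1 (r * cosh_fps)) ?mulr1 //.
    by rewrite exprMn cosh_fps_sqr.
  by rewrite fps_coef0M r0 cosh_fps0 mulr1.
apply/eqP; rewrite -subr_eq0 (@fps_deriv_eq0 R R idfun (a - _) 0) ?rmorph0 //.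
  rewrite fps_derivB Da fps_derivM fps_derivC mul0r add0r.
  have -> : fps_deriv (fpsX R) = 1.
    apply/funext => n; rewrite /fps_deriv /fpsX /fps_of_poly coefX fps_coef1 eqSS.
    by case: n => [|n] //=; rewrite mul0rn.
  by rewrite mulr1 subrr.
by rewrite fps_coefB fps_coefCM /fpsX /fps_of_poly coefX /= mulr0 subr0 /a (asinh_comp_coef0 idfun).
Qed.

(** At [gamma = 1] the relation [m^2 = 1 + d^2 / 4] turns the radicand into the perfect square of
    [m - theta d / 2]. Its root cancels that factor of the numerator and leaves [d / 2]. *)
Lemma full_coupling_sinh : full (sinh_series theta) = sinh_fps.
Proof.
have [md d1 d2] := And3 (@symbol_order_mu_delta _ m d central_diff0)
  (@symbol_order_delta_sqr1 _ m d central_diff0) (@symbol_order_delta_sqr2 _ m d central_diff0).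
have FF := symbol_filtration m d.
have nf := num_series_filtered theta FF md d1.
have rf := rad_series_filtered theta FF md d1 d2.
have wf := rsqrt_series_filtered theta FF md d1 d2.
rewrite full_couplingM // full_coupling_comp ?rad_series0 //.
pose b := m - fpsC (2^-1 * theta) * d.
have -> : full (num_series theta) = fpsC 2^-1 * b * d.
  (* Summing [q.+2] terms exposes the [gamma^1] coefficient even for [q = 0]; the radicand below
     takes [q.+3] for its [gamma^2] coefficient. *)
  apply/funext => q; rewrite (full_coupling_wide nf (ltnW (ltnSn q.+1))).
  rewrite 2!big_ord_recl big1 => [|i _].
    rewrite num_series0 rmorph0 add0r addr0 /num_series /fps_of_poly /cf_num coefZ coefX /= mulr1.
    by rewrite /b !(rmorphM, rmorphB) /= !symbolC symbol_mu symbol_delta.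
  by rewrite /num_series /fps_of_poly /cf_num coefZ coefX mulr0 rmorph0.
have radE : 1 + full (rad_series theta) = b ^+ 2.
  have -> : full (rad_series theta) = fpsC 2^-1 * d ^+ 2 - fpsC theta * m * d
       + fpsC (4^-1 * (theta ^+ 2 - 1)) * d ^+ 2.
    apply/funext => q; rewrite (full_coupling_wide rf (ltnW (ltnW (ltnSn q.+2)))).
    rewrite 3!big_ord_recl big1 => [|i _].
      rewrite rad_series0 rmorph0 add0r addr0 /rad_series /fps_of_poly /cf_rad.
      rewrite !(coefD, coefN, coefZ, coefX, coefXn) /= !mulr1 !mulr0 subr0 addr0 add0r.
      rewrite fps_coefD; congr (_ + _).
        by rewrite !expr2 !(rmorphM, rmorphB) /= !symbolC symbol_mu symbol_delta.
      by rewrite !expr2 !(rmorphM, rmorphB, rmorph1) /= !symbolC symbol_delta.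
    rewrite /rad_series /fps_of_poly /cf_rad.
    by rewrite !(coefD, coefN, coefZ, coefX, coefXn) /= !mulr0 subr0 addr0 rmorph0.
  have e2 : fpsC 2^-1 * 2 = 1 :> fps R.
    by rewrite -(rmorph_nat (@fpsC R)) -rmorphM mulVf ?rmorph1 ?pnatr_eq0.
  have m2 := central_mean_sqr; rewrite (_ : 4^-1 = 2^-1 ^+ 2) in m2 *; last by field.
  rewrite /b !(rmorphM, rmorphB, rmorphXn, rmorph1) /= in m2 *.
  set e := fpsC 2^-1 in e2 m2 *; set t := fpsC theta.
  transitivity (m ^+ 2 - (e * 2) * (m * t * d) + e ^+ 2 * t ^+ 2 * d ^+ 2); last by ring.
  rewrite m2 e2 mul1r.
  transitivity (1 + (e * 2) * e * d ^+ 2 - t * m * d + e ^+ 2 * (t ^+ 2 - 1) * d ^+ 2).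
    by rewrite e2; ring.
  by ring.
set w := fps_comp _ _.
have wb : w * b = 1.
  apply: fps_sqrt1; rewrite ?exprMn -?radE.
    apply: (rsqrt1p_comp_sqr idfun).
    by rewrite full_coupling_coef0 rad_series0 rmorph0.
  rewrite fps_coef0M /w fps_comp_coef0 /b fps_coefB fps_coefCM central_diff0 mulr0 subr0 [m 0%N]cosh_fps0.
  by rewrite /rsqrt1p_coef big_ord0 fact0 divr1 mulr1.
transitivity (fpsC 2^-1 * d * (w * b)); first by ring.
rewrite wb mulr1 central_diffE mulrA -rmorphM mulVf ?pnatr_eq0 //.
by rewrite rmorph1 mul1r.
Qed.
End Consistency.

Lemma holistic_consistent (R : realType) (c H theta : R) p : H != 0 ->
  consistent_with_wave c p (equivalent_pde c H theta p 1).
Proof.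
move=> H0 q qp; rewrite /equivalent_pde.
set d : fps R := fun k => 2 * sinh_coef (H / 2) k.
have d0 : d 0%N = 0 by rewrite /d /sinh_coef mulr0.
have FF := symbol_filtration (cosh_fps (H / 2)) d.
have [md d1 d2] := And3 (@symbol_order_mu_delta _ (cosh_fps (H / 2)) d d0)
  (@symbol_order_delta_sqr1 _ (cosh_fps (H / 2)) d d0)
  (@symbol_order_delta_sqr2 _ (cosh_fps (H / 2)) d d0).
have af := asinh_series_filtered theta FF md d1 d2.
have zf := sinh_series_filtered theta FF md d1 d2.
transitivity (- (2 * c / H) * full_coupling (cosh_fps (H / 2)) d (asinh_series theta) q).
  (* The discarded powers [gamma^n], [n >= p], have order at least [p] in [d/dx], so they do not
     reach [dx^q] for [q < p]. *)
  rewrite (full_coupling_wide af qp) mulr_sumr; apply: eq_bigr => n _.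
  rewrite expr1n mul1r symbolE holistic_coefE rmorphM /= symbolC.
  by rewrite fps_coefCM.
rewrite full_coupling_comp ?sinh_series0 // full_coupling_sinh asinh_sinh_fps.
rewrite fps_coefCM /fpsX /fps_of_poly coefX; case: eqP => _; last by rewrite !mulr0.
by rewrite mulr1; field.
Qed.

(** * From operator stencils to the stencil width of the scheme *)

Lemma stencil_width (R : realType) p (P : opPoly R) : (0 < p)%N ->
  stencil p.-1 P -> stencil_width_2p_minus_1 p (apply_op P).
Proof.
move=> p0 [l lp lE].
(* Weights sharing an offset are added up; position [i] stands for the offset [i - (p - 1)]. *)
exists (fun i => \sum_(u <- l | u.2 == i%:Z - p.-1%:Z) u.1) => V j.
rewrite lE; under [RHS]eq_bigr => i _ do rewrite mulr_suml big_mkcond.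
rewrite exchange_big /= big_seq [RHS]big_seq; apply: eq_bigr => u ul.
have up : (`|u.2| <= p.-1)%N by move/allP: lp => /(_ _ ul).
have i0 : (`|(u.2 + p.-1%:Z)%R| < 2 * p - 1)%N by lia.
have iE : (Ordinal i0)%:Z = u.2 + p.-1%:Z.
  have aux (z : int) k : (`|z| <= k)%N -> 0 <= z + k%:Z by lia.
  by rewrite /= gez0_abs //; exact: aux.
rewrite -big_mkcond (big_pred1 (Ordinal i0)) => [|i].
  by rewrite iE -addrA addrK rmorphD.
apply/eqP/eqP => [E|->]; last by rewrite iE addrK.
by apply/val_inj => /=; rewrite E subrK.
Qed.

Lemma holistic_stencil (R : realType) (c H theta gamma : R) p : (0 < p)%N ->
  stencil_width_2p_minus_1 p (holistic_rhs c H theta p gamma).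
Proof.
move=> p0.
have E : holistic_rhs c H theta p gamma =
    apply_op (\sum_(n < p) opC (gamma ^+ n) * holistic_coef c H theta n).
  apply/funext => V; apply/funext => s; rewrite apply_op_sum.
  by apply: eq_bigr => n _; rewrite apply_opCM.
rewrite E; apply: stencil_width => //.
apply: (filtered_sum (stencil_filtration R)) => n _.
apply: (filteredC (stencil_filtration R)).
apply: (@stencil_leq _ n); last exact: holistic_coef_stencil.
by rewrite -ltnS prednK.
Qed.

(** * Grid values of polynomial subgrid fields *)

Section GridValue.
Variables (R : realType) (x0 H : R).
Hypothesis hH : 0 < H.
Implicit Types (q : {poly R}) (j : int).

Definition midpoint j : R := Ledge H x0 j + H / 2.

Lemma RedgeE j : Redge H x0 j = Ledge H x0 j + H.
Proof. by rewrite /Redge /Ledge rmorphD /= mulrDl mul1r addrA. Qed.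

Lemma Ledge_midpoint j : Ledge H x0 j - midpoint j = - (H / 2).
Proof. by rewrite /midpoint; ring. Qed.
Lemma Redge_midpoint j : Redge H x0 j - midpoint j = H / 2.
Proof. by rewrite RedgeE /midpoint; field. Qed.
Lemma Ledge_lt_Redge j : Ledge H x0 j < Redge H x0 j.
Proof. by rewrite RedgeE ltrDl. Qed.

Lemma midpoint_in j : midpoint j \in `]Ledge H x0 j, Redge H x0 j[.
Proof. by rewrite in_itv /= RedgeE /midpoint; apply/andP; split; move: hH; lra. Qed.

(** The grid value of the monomial [(x - mid)^k]. *)
Definition moment (kind : grid_value_kind) k : R :=
  match kind with
  | Midpoint => (k == 0%N)%:R
  | Average => H^-1 * (((H / 2) ^+ k.+1 - (- (H / 2)) ^+ k.+1) / k.+1%:R)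
  end.

Lemma moment0 kind : moment kind 0 = 1.
Proof. by case: kind => //=; rewrite !expr1; field; rewrite gt_eqF. Qed.

Definition antideriv q : {poly R} :=
  \poly_(k < (size q).+1) (if k is k'.+1 then q`_k' / k%:R else 0).

Lemma antiderivK q : (antideriv q)^`() = q.
Proof.
apply/polyP => k; rewrite coef_deriv coef_poly ltnS.
case: ltnP => [_|qk]; last by rewrite mul0rn nth_default.
by rewrite /= -[_ *+ _]mulr_natr divfK // pnatr_eq0.
Qed.

Lemma horner_antideriv q (x : R) :
  (antideriv q).[x] = \sum_(k < size q) q`_k * (x ^+ k.+1 / k.+1%:R).
Proof.
rewrite horner_poly big_ord_recl mul0r add0r; apply: eq_bigr => k _ /=.
by rewrite mulrAC -mulrA.
Qed.

Lemma horner_sub q (a x : R) : q.[x - a] = (q \Po ('X - a%:P)).[x].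
Proof. by rewrite horner_comp !hornerE. Qed.

Lemma is_derive_horner_sub q (a x : R) :
  is_derive x 1 (fun y => q.[y - a]) (q^`()).[x - a].
Proof.
have -> : (fun y => q.[y - a]) = horner (q \Po ('X - a%:P)).
  by apply/funext => y; rewrite horner_sub.
apply: DeriveDef; first exact: derivable_horner.
rewrite -derive1E -derivE deriv_comp derivB derivX derivC subr0 mulr1.
by rewrite horner_sub.
Qed.

Lemma continuous_horner_sub q (a : R) : continuous (fun y => q.[y - a]).
Proof.
have -> : (fun y => q.[y - a]) = horner (q \Po ('X - a%:P)).
  by apply/funext => y; rewrite horner_sub.
exact: continuous_horner.
Qed.

Lemma grid_value_horner kind j (f : R -> R) q m :
  {in `[Ledge H x0 j, Redge H x0 j], forall x, f x = q.[x - midpoint j]} ->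
  (size q <= m)%N ->
  grid_value H x0 kind j f = \sum_(k < m) q`_k * moment kind k.
Proof.
move=> fq qm; have LR := Ledge_lt_Redge j.
rewrite [RHS](_ : _ = \sum_(k < size q) q`_k * moment kind k); last first.
  rewrite [RHS](big_ord_widen m (fun k => q`_k * moment kind k)) // [RHS]big_mkcond.
  apply: eq_bigr => k _; case: ifPn => //.
  by rewrite -leqNgt => ?; rewrite nth_default ?mul0r.
case: kind => /=.
  have E : (Ledge H x0 j + Redge H x0 j) / 2 = midpoint j.
    by rewrite RedgeE /midpoint; field.
  rewrite E fq; last by rewrite -E in_itv /=; apply/andP; split; lra.
  rewrite subrr horner_coef0; case: (posnP (size q)) => [q0|q0].
    by rewrite q0 big_ord0 nth_default ?q0.
  rewrite -(prednK q0) big_ord_recl /= mulr1 big1 ?addr0 // => i _.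
  by rewrite mulr0.
under [RHS]eq_bigr do rewrite mulrCA.
rewrite -mulr_sumr; congr (_ * _).
transitivity (\int[lebesgue_measure]_(x in `[Ledge H x0 j, Redge H x0 j])
    q.[x - midpoint j]).
  by apply: eq_Rintegral => x /[!inE] xj; rewrite fq.
rewrite /Rintegral (continuous_FTC2 (F := fun x => (antideriv q).[x - midpoint j]) LR).
- rewrite -EFinB /= Ledge_midpoint Redge_midpoint !horner_antideriv -sumrB.
  by apply: eq_bigr => k _; rewrite -mulrBr -mulrBl.
- by apply: continuous_subspaceT => x; exact: continuous_horner_sub.
- split=> [x _||].
  + by have [] := is_derive_horner_sub (antideriv q) (midpoint j) x.
  + by apply: cvg_at_right_filter; exact: continuous_horner_sub.
  + by apply: cvg_at_left_filter; exact: continuous_horner_sub.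
- move=> x _; rewrite derive1E.
  by have [_ ->] := is_derive_horner_sub (antideriv q) (midpoint j) x; rewrite antiderivK.
Qed.
End GridValue.

(** * The canonical slow manifold *)

(** Used to read powers of a position [x] in the exponential series as a rescaled exponent. *)
Lemma fps_comp_scale (A : comNzRingType) (f a : fps A) (x : A) :
  fps_comp (fun k => f k * x ^+ k) a = fps_comp f (fpsC x * a).
Proof.
apply/funext => n; rewrite /fps_comp; apply: eq_bigr => k _.
by rewrite !fps_expE exprMn -rmorphXn fps_coefCM mulrA.
Qed.

Section CanonicalManifold.
Variables (R : realType) (c H theta x0 : R) (N : nat) (kind : grid_value_kind).
Hypothesis hH : 0 < H.
Implicit Types (U W : int -> R) (j : int) (n k p : nat) (x : R).
Local Notation A := (opPoly R).
Local Notation mid := (midpoint x0 H).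
Local Notation alpha := (moment H kind).

(** The exponent [2 A / H] per unit length of the subgrid exponential; [- c] times it is the
    evolution rate. *)
Definition growth_series : fps A := fpsC (opC (2 / H)) * asinh_series theta.

(** The grid value of that exponential centred at the midpoint: each power of [x - mid] is replaced
    by its moment. *)
Definition average_series : fps A :=
  fps_comp (fps_map (@opC R) (fun k => k`!%:R^-1 * alpha k)) growth_series.

(* dividing by the grid value of the exponential subgrid field enforces the
   definition of the macroscale grid values *)
Definition norm_series : fps A := fps_inv (@opC R) average_series.

(** The coefficient of [gamma^n (x - mid)^k] in the normalised exponential. It vanishes for [k > n],
    as the exponent has no [gamma^0] term, so each order is polynomial in [x]. *)
Definition field_coef n k : A :=
  opC k`!%:R^-1 * (norm_series * growth_series ^+ k) n.

Definition field_poly n U j : {poly R} :=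
  \poly_(k < n.+1) grid_op (field_coef n k) U j.

Definition slow_field n U j x := (field_poly n U j).[x - mid j].
Definition slow_rate n U j := grid_op (holistic_coef c H theta n) U j.

Lemma growth_series0 : growth_series 0%N = 0.
Proof. by rewrite /growth_series fps_coefCM asinh_series0 mulr0. Qed.

Lemma average_series0 : average_series 0%N = 1.
Proof. by rewrite /average_series fps_comp_coef0 /fps_map moment0 // fact0 invr1 mulr1 rmorph1. Qed.

Lemma norm_seriesV : norm_series * average_series = 1.
Proof. exact: fps_mulV average_series0. Qed.

Lemma growth_series_stencil : fps_filtered (@stencil R) growth_series.
Proof.
apply: (fps_filteredC (stencil_filtration R)); exact: asinh_series_stencil.
Qed.

Lemma norm_series_stencil : fps_filtered (@stencil R) norm_series.
Proof.
have FF := stencil_filtration R.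
apply: (fps_filtered_comp FF) => n; rewrite fps_coefB; apply: (filtrationD FF).
  exact: (fps_filtered1 FF).
rewrite -mulN1r -(rmorph1 (@opC R)) -rmorphN; apply: (filteredC FF).
exact: (fps_filtered_comp FF _ growth_series_stencil).
Qed.

Lemma field_coef_local n k : grid_local (field_coef n k).
Proof.
have FF := stencil_filtration R.
exists n; apply: (filteredC FF); apply: (fps_filteredM FF norm_series_stencil).
exact: (fps_filteredX FF k growth_series_stencil).
Qed.

Lemma holistic_coef_local n : grid_local (holistic_coef c H theta n).
Proof. by exists n; exact: holistic_coef_stencil. Qed.

Lemma field_coef_small n k : (n < k)%N -> field_coef n k = 0.
Proof.
move=> nk; rewrite /field_coef fps_coefM big1 ?mulr0 // => i _.
rewrite (fps_exp_coef_small growth_series0) ?mulr0 //.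
exact: leq_ltn_trans (leq_subr _ _) nk.
Qed.

Lemma coef_field_poly n U j k : (field_poly n U j)`_k = grid_op (field_coef n k) U j.
Proof.
rewrite coef_poly; case: ltnP => // nk.
by rewrite field_coef_small // grid_op0.
Qed.

Lemma size_field_poly n U j m : (n < m)%N -> (size (field_poly n U j) <= m)%N.
Proof. by move=> nm; exact: leq_trans (size_poly _ _) nm. Qed.

(** Covers any linear functional sending [(x - mid)^k] to [t k]: powers give point evaluation,
    moments give the grid value. *)
Lemma sum_field_coef (t : nat -> R) n U j :
  \sum_(k < n.+1) grid_op (field_coef n k) U j * t k =
  grid_op ((norm_series *
    fps_comp (fps_map (@opC R) (fun k => k`!%:R^-1 * t k)) growth_series) n) U j.
Proof.
transitivity (grid_op ((norm_series * \sum_(k < n.+1)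
    fpsC (opC (k`!%:R^-1 * t k)) * growth_series ^+ k) n) U j).
  rewrite mulr_sumr fps_coef_sum grid_op_sum; apply: eq_bigr => k _.
  rewrite mulrCA fps_coefCM /field_coef !grid_opCM; ring.
congr grid_op; apply: fps_coefM_eq => // i ni.
by rewrite (fps_comp_coef _ growth_series0 (m := n.+1)).
Qed.

Lemma field_poly_horner n U j x : (field_poly n U j).[x] =
  grid_op ((norm_series *
    fps_comp (fps_map (@opC R) (@exp_coef R)) (fpsC (opC x) * growth_series)) n) U j.
Proof.
rewrite horner_poly sum_field_coef -fps_comp_scale; congr (grid_op ((_ * fps_comp _ _) _) _ _).
by apply/funext => k; rewrite /fps_map /exp_coef rmorphM rmorphXn.
Qed.

Definition right_series := norm_series * (cosh_series theta + sinh_series theta).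
Definition left_series := norm_series * (cosh_series theta - sinh_series theta).

Lemma growth_seriesK : fpsC (opC (H / 2)) * growth_series = asinh_series theta.
Proof.
rewrite /growth_series mulrA -!rmorphM /= (_ : H / 2 * (2 / H) = 1).
  by rewrite !rmorph1 mul1r.
by field; rewrite gt_eqF.
Qed.

Lemma slow_field_right n U j :
  slow_field n U j (Redge H x0 j) = grid_op (right_series n) U j.
Proof.
rewrite /slow_field Redge_midpoint field_poly_horner growth_seriesK.
by rewrite /asinh_series exp_asinh ?sinh_series0.
Qed.

Lemma slow_field_left n U j :
  slow_field n U j (Ledge H x0 j) = grid_op (left_series n) U j.
Proof.
rewrite /slow_field Ledge_midpoint field_poly_horner !rmorphN mulNr growth_seriesK.
by rewrite /asinh_series exp_asinhN ?sinh_series0.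
Qed.

Lemma field_poly_grid_value n U j :
  grid_value H x0 kind j (slow_field n U j) = if n == 0%N then U j else 0.
Proof.
have fq : {in `[Ledge H x0 j, Redge H x0 j], forall x,
  slow_field n U j x = (field_poly n U j).[x - mid j]} by [].
rewrite (grid_value_horner hH kind fq (size_poly _ _)).
under eq_bigr do rewrite coef_field_poly.
rewrite sum_field_coef norm_seriesV fps_coef1.
by case: eqP => _; rewrite ?grid_op1 ?grid_op0.
Qed.

(** The wave equation on coefficients: the rate is [- c] times the growth series, and one more
    factor of growth raises [k] to [k.+1]. *)
Lemma field_coef_rate n k :
  \sum_(m < n.+1) field_coef m k * holistic_coef c H theta (n - m)%N =
  opC (- (c * k.+1%:R)) * field_coef n k.+1.
Proof.
have hE m : holistic_coef c H theta m = opC (- c) * growth_series m.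
  rewrite holistic_coefE /growth_series fps_coefCM mulrA -rmorphM /=.
  by congr (opC _ * _); ring.
rewrite /field_coef exprSr [norm_series * (_ * _)]mulrA [in RHS]fps_coefM !mulr_sumr; apply: eq_bigr => i _.
rewrite hE mulrACA [RHS]mulrA -!rmorphM /=; congr (opC _ * _).
have n0 : k.+1%:R != 0 :> R by rewrite pnatr_eq0.
have f0 : k`!%:R != 0 :> R by rewrite pnatr_eq0 -lt0n fact_gt0.
by rewrite factS natrM; field; rewrite f0 nat1r n0.
Qed.

Lemma slow_field_dt n U j x :
  field_dt slow_field slow_rate n U j x =
  - (c * (field_poly n U j)^`().[x - mid j]).
Proof.
rewrite /field_dt /slow_field; set y := x - mid j.
transitivity (\sum_(m < n.+1) \sum_(k < n.+1)
    grid_op (field_coef m k * holistic_coef c H theta (n - m)%N) U j * y ^+ k).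
  apply: eq_bigr => m _.
  (* All orders [m <= n] are padded to the common length [n.+1], so that the two sums can be
     exchanged. *)
  rewrite (@horner_coef_wide _ n.+1) ?size_field_poly //.
  apply: eq_bigr => k _; rewrite coef_field_poly; congr (_ * _).
  rewrite grid_opM //; [exact: field_coef_local | exact: holistic_coef_local].
rewrite exchange_big (@horner_coef_wide _ n.+1); last first.
  by rewrite (leq_trans (size_poly _ _)) // (leq_trans (leq_pred _)) // size_poly.
rewrite mulr_sumr -sumrN; apply: eq_bigr => k _.
rewrite -mulr_suml -grid_op_sum field_coef_rate grid_opCM coef_deriv coef_field_poly.
by rewrite -[_ *+ _]mulr_natr; ring.
Qed.

End CanonicalManifold.

(** * The coupling condition for the exponential fields *)

Lemma coupling_identity (B : comNzRingType) (e t m d x s k Z : B) :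
  let r := Z * (k + s) in let l := Z * (k - s) in
  let next := 1 + m * d + e * (d * d) in let prev := 1 - m * d + e * (d * d) in
  (r - l) - e * (x * (r - l)) - e * (x * (next * l - prev * r))
  - e * t * (x * (l + r)) + e * t * (x * (next * l + prev * r)) =
  2 * Z * (s * (1 + (e ^+ 2 * d ^+ 2 - e * t * m * d) * x)
    - e * (m - e * t * d) * d * x * k).
Proof. by rewrite /=; ring. Qed.

Section Coupling.
Variables (R : realType) (c H theta x0 : R) (N : nat) (kind : grid_value_kind).
Hypothesis hH : 0 < H.
Implicit Types (U W : int -> R) (j : int) (n k p : nat) (x : R).
Local Notation A := (opPoly R).
Local Notation v := (slow_field H theta x0 kind).
Local Notation g := (slow_rate c H theta).
Local Notation eR := (right_series H theta kind).
Local Notation eL := (left_series H theta kind).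

(** Left minus right side of the coupling condition as an operator series, with neighbours reached
    by multiplying with the shift symbols. *)
Definition coupling_defect : fps A :=
  (eR - eL) - fpsC (opC 2^-1) * (fpsX A * (eR - eL))
  - fpsC (opC 2^-1) * (fpsX A * (fpsC (next_sym R) * eL - fpsC (prev_sym R) * eR))
  - fpsC (opC (2^-1 * theta)) * (fpsX A * (eL + eR))
  + fpsC (opC (2^-1 * theta)) *
      (fpsX A * (fpsC (next_sym R) * eL + fpsC (prev_sym R) * eR)).

(** With edges [Z (cosh + sinh)] and [Z (cosh - sinh)] the defect is [2 Z] times
    [sinh (1 + den) - num cosh]. As [sinh = num rsqrt], a factor [num] splits off and leaves the
    null difference for cosh. *)
Lemma coupling_defectE : coupling_defect =
  2 * norm_series H theta kind * num_series theta *
  (rsqrt_series theta * (1 + den_series theta) - cosh_series theta).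
Proof.
pose e : fps A := fpsC (opC 2^-1); pose t : fps A := fpsC (opC theta).
pose m : fps A := fpsC (mu_sym R); pose d : fps A := fpsC (delta_sym R).
have Cf (a : A) : fps_of_poly a%:P = fpsC a by [].
have tE : fpsC (opC (2^-1 * theta)) = e * t by rewrite -!rmorphM.
have mdE : fpsC (mu_sym R * delta_sym R) = m * d by rewrite rmorphM.
have ddE : fpsC (opC 2^-1 * (delta_sym R * delta_sym R)) = e * (d * d).
  by rewrite !(rmorphM (@fpsC A)).
have nextE : fpsC (next_sym R) = 1 + m * d + e * (d * d).
  by rewrite /next_sym !(rmorphD (@fpsC A)) /= mdE ddE rmorph1.
have prevE : fpsC (prev_sym R) = 1 - m * d + e * (d * d).
  rewrite /prev_sym (rmorphN (@opC R)) (rmorph1 (@opC R)) mulN1r.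
  by rewrite !(rmorphD (@fpsC A)) (rmorphN (@fpsC A)) /= mdE ddE rmorph1.
have denE : den_series theta = (e ^+ 2 * d ^+ 2 - e * t * m * d) * fpsX A.
  rewrite /den_series -mul_polyC (rmorphM (@fps_of_poly A)); congr (_ * _).
  by rewrite /= Cf (rmorphB (@fpsC A)) !(rmorphM (@fpsC A)) /= !expr2.
have numE : num_series theta = e * (m - e * t * d) * d * fpsX A.
  rewrite /num_series /cf_num -mul_polyC (rmorphM (@fps_of_poly A)); congr (_ * _).
  by rewrite /= Cf !(rmorphM (@fpsC A)) (rmorphB (@fpsC A)) (rmorphM (@fpsC A)) /= tE.
rewrite /coupling_defect /right_series /left_series nextE prevE tE -/e.
rewrite coupling_identity -denE -numE /sinh_series.
by move: (num_series _) (rsqrt_series _) (den_series _) (cosh_series _)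
  (norm_series _ _ _) => n w D k Z; ring.
Qed.

Lemma null_op_seriesM (a b : fps A) :
  (forall n, null_op (b n)) -> forall n, null_op ((a * b) n).
Proof.
move=> b0 n; rewrite fps_coefM; elim/big_rec: _ => [|i x _ IH]; first exact: null_op0.
by apply: null_opD => //; apply: null_opM.
Qed.

Lemma coupling_defect_null n U j : grid_op (coupling_defect n) U j = 0.
Proof.
apply: grid_op_null; rewrite coupling_defectE; apply: null_op_seriesM => k.
exact: null_op_cosh_series.
Qed.

Lemma coef_uR n p U j : (n < p)%N -> (uR H x0 v p U j)`_n = grid_op (eR n) U j.
Proof. by move=> np; rewrite coef_poly np slow_field_right. Qed.

Lemma coef_uL n p U j : (n < p)%N -> (uL H x0 v p U j)`_n = grid_op (eL n) U j.
Proof. by move=> np; rewrite coef_poly np slow_field_left. Qed.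

Lemma slow_field_coupling p U j :
  take_poly p (coupling_lhs H x0 v p U j) = take_poly p (coupling_rhs H theta x0 v p U j).
Proof.
apply/polyP => n; rewrite !coef_take_poly; case: ifPn => // np.
rewrite /coupling_lhs /coupling_rhs mulrBl mul1r -!scalerAl.
have np' : (n.-1 < p)%N by exact: leq_ltn_trans (leq_pred n) np.
rewrite !(coefB, coefD, coefZ, coefXM) !coef_uR // !coef_uL //.
have := coupling_defect_null n U j.
have BE (P Q : A) : P - Q = P + opC (-1) * Q by rewrite rmorphN rmorph1 mulN1r.
rewrite /coupling_defect.
rewrite !(fps_coefB, fps_coefD, fps_coefCM, fps_coefXM).
case: n np np' => [|n] np np' /=.
  by rewrite !BE !mulr0 !grid_opD !grid_opCM !grid_op0; lra.
rewrite !(fps_coefB, fps_coefD, fps_coefCM, fps_coefXM).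
by rewrite !BE !(grid_opD, grid_opCM, grid_op_next, grid_op_prev); lra.
Qed.

Lemma slow_field_is_slow_manifold p : slow_manifold c H theta x0 N kind v g p.
Proof.
split.
- by move=> n U _ UN; exact: grid_op_periodic.
- move=> n U j x _ UN _; rewrite /slow_field.
  have -> : field_poly H theta kind n U (j + N%:Z) = field_poly H theta kind n U j.
    by apply/polyP => k; rewrite !coef_field_poly //; exact: grid_op_periodic.
  by congr (_.[_]); rewrite /midpoint /Ledge rmorphD /=; ring.
- by move=> n a U W j _ _ _; exact: grid_op_lin.
- move=> n a U W j x _ _ _ _; rewrite /slow_field !horner_poly mulr_sumr -big_split.
  by apply: eq_bigr => k _; rewrite grid_op_lin mulrDl mulrA.
- move=> U j x _ _; rewrite /slow_field horner_poly big_ord1 expr0 mulr1 /field_coef.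
  rewrite fact0 invr1 rmorph1 mul1r expr0 mulr1.
  have -> : norm_series H theta kind 0%N = 1.
    have := congr1 (fun f : fps A => f 0%N) (norm_seriesV theta kind hH).
    by rewrite fps_coef0M average_series0 // mulr1 fps_coef1.
  by rewrite grid_op1.
- by move=> n U j _ _; exact: field_poly_grid_value.
- by move=> n U j _ _; apply: continuous_subspaceT => x; exact: continuous_horner_sub.
- move=> n U j x _ _ _.
  by have [] := is_derive_horner_sub (field_poly H theta kind n U j) (midpoint x0 H j) x.
- move=> n U j x _ _ _; rewrite slow_field_dt // derive1E.
  have [_ ->] := is_derive_horner_sub (field_poly H theta kind n U j) (midpoint x0 H j) x.
  by rewrite addNr.
- by move=> U j _; exact: slow_field_coupling.
Qed.
End Coupling.

(** * Uniqueness of the evolution *)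

Section Uniqueness.
Variables (R : realType) (c H theta x0 : R) (N p : nat) (kind : grid_value_kind).
Hypothesis hH : 0 < H.
Implicit Types (U W : int -> R) (j : int) (n k : nat) (x : R).
Local Notation A := (opPoly R).
Local Notation element j := `[Ledge H x0 j, Redge H x0 j].

Section OneManifold.
Variables (v : nat -> (int -> R) -> int -> R -> R) (g : nat -> (int -> R) -> int -> R).
Hypothesis sm : slow_manifold c H theta x0 N kind v g p.

Lemma grid_periodic0 : grid_periodic N (fun=> 0 : R). Proof. by []. Qed.

Lemma slow_manifold_field0 n j x : (n < p)%N -> x \in element j -> v n (fun=> 0) j x = 0.
Proof.
move=> np xj.
have := sm_v_linear sm (-1) np grid_periodic0 grid_periodic0 xj.
rewrite (_ : (fun _ : int => -1 * 0 + 0) = fun=> 0 : R); last by apply/funext => i; ring.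
by move=> E; rewrite E; ring.
Qed.

(** Isolates the order-[n] rate: the term [m = 0] is [g n U j] since [v 0] reproduces grid values,
    and for [n > 0] the term [m = n] vanishes with [g 0]. What remains involves orders strictly
    between 0 and [n]. *)
Lemma slow_manifold_dt n U j x : (n < p)%N -> grid_periodic N U -> x \in element j ->
  ((0 < n)%N -> g 0%N U = fun=> 0) ->
  field_dt v g n U j x =
  g n U j + \sum_(m < n.-1) v m.+1 (g (n.-1 - m)%N U) j x.
Proof.
move=> np UN xj g0; rewrite /field_dt.
have v0 : v 0%N (g n U) j x = g n U j.
  by apply: (sm_base sm) => //; exact: (sm_g_periodic sm).
case: n np g0 v0 => [|n] np g0 v0; first by rewrite big_ord1 big_ord0 addr0.
rewrite big_ord_recl subn0 v0; congr (_ + _).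
rewrite big_ord_recr /= subnn g0 // slow_manifold_field0 // addr0.
by apply: eq_bigr => m _; rewrite /= /bump leq0n add1n subSS.
Qed.

(** Every coupling term except the leading jump carries a factor gamma, so order [n] of the jump is
    fixed by edge values of order [n - 1]. *)
Lemma slow_manifold_edges n U j : (n < p)%N -> grid_periodic N U ->
  v n U j (Redge H x0 j) - v n U j (Ledge H x0 j) =
  if n is k.+1 then
    2^-1 * (v k U j (Redge H x0 j) - v k U j (Ledge H x0 j))
    + 2^-1 * (v k U (j + 1) (Ledge H x0 (j + 1)) - v k U (j - 1) (Redge H x0 (j - 1)))
    + 2^-1 * theta * (v k U j (Ledge H x0 j) + v k U j (Redge H x0 j))
    - 2^-1 * theta * (v k U (j + 1) (Ledge H x0 (j + 1)) + v k U (j - 1) (Redge H x0 (j - 1)))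
  else 0.
Proof.
move=> np UN; have := congr1 (fun q : {poly R} => q`_n) (sm_coupling sm j UN).
rewrite /= !coef_take_poly np /coupling_lhs /coupling_rhs mulrBl mul1r -!scalerAl.
have np' : (n.-1 < p)%N by exact: leq_ltn_trans (leq_pred n) np.
rewrite !(coefB, coefD, coefZ, coefXM) !coef_poly np np'.
case: n np np' => [|n] np np' /=; first by rewrite !mulr0; lra.
by move=> E; lra.
Qed.

End OneManifold.

Local Notation v' := (slow_field H theta x0 kind).
Local Notation g' := (slow_rate c H theta).

Lemma slow_rate0 U : g' 0%N U = fun=> 0.
Proof.
apply/funext => j; rewrite /slow_rate holistic_coefE asinh_series0 mulr0.
exact: grid_op0.
Qed.

(* For [c = 0] the subgrid fields are not unique, but the rates still are. *)
Lemma slow_manifold_no_wave v g : c = 0 -> slow_manifold c H theta x0 N kind v g p ->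
  forall n U j, (n < p)%N -> grid_periodic N U -> g n U j = 0.
Proof.
move=> c0 sm n; elim/ltn_ind: n => n IH U j np UN.
have LR := Ledge_lt_Redge x0 hH j.
pose x := midpoint x0 H j.
have xo : x \in `]Ledge H x0 j, Redge H x0 j[ := midpoint_in x0 hH j.
have xc : x \in element j by exact: subset_itv_oo_cc xo.
have gz k : (k < n)%N -> g k U = fun=> 0.
  by move=> kn; apply/funext => i; rewrite IH // (ltn_trans kn).
(* For [c = 0] the equation reads [field_dt = 0]; with all lower rates zero, only [g n U j] is left
   in it. *)
have := sm_pde sm np UN xo.
rewrite c0 mul0r addr0 (slow_manifold_dt sm) // => [|n0]; last exact: gz.
rewrite big1 ?addr0 // => m _; case: n m np gz {IH} => [|n] /= m np gz; first by case: m.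
rewrite gz ?ltnS ?leq_subr // (slow_manifold_field0 sm) //.
by rewrite (ltn_trans _ np) // ltnS.
Qed.

Lemma slow_manifold_unique v g : c != 0 -> slow_manifold c H theta x0 N kind v g p ->
  forall n U j, (n < p)%N -> grid_periodic N U ->
  g n U j = g' n U j /\ {in element j, forall x, v n U j x = v' n U j x}.
Proof.
move=> c0 sm n; elim/ltn_ind: n => n IH U j np UN.
have sm' : slow_manifold c H theta x0 N kind v' g' p :=
  slow_field_is_slow_manifold c theta x0 N kind hH p.
have LR := Ledge_lt_Redge x0 hH j.
have gE k W : (k < n)%N -> grid_periodic N W -> g k W = g' k W.
  by move=> kn WN; apply/funext => i; have [] := IH k kn W i (ltn_trans kn np) WN.
have vE k W i x : (k < n)%N -> grid_periodic N W -> x \in element i ->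
    v k W i x = v' k W i x.
  by move=> kn WN xi; have [_] := IH k kn W i (ltn_trans kn np) WN; exact.
pose D := g n U j - g' n U j.
pose w x := v n U j x - v' n U j x.
(* By induction the intermediate terms agree, so the time derivatives differ by the constant [D]. *)
have dtE x : x \in element j -> field_dt v g n U j x - field_dt v' g' n U j x = D.
  move=> xj; rewrite (slow_manifold_dt sm) // => [|n0]; last first.
    by rewrite gE // slow_rate0.
  rewrite (slow_manifold_dt sm') // => [|n0]; last by rewrite slow_rate0.
  rewrite (eq_bigr (fun m : 'I_n.-1 => v' m.+1 (g' (n.-1 - m)%N U) j x)) /D; first by ring.
  move=> m _; have mn : (m.+1 < n)%N by have := ltn_ord m; lia.
  rewrite gE //; last by lia.
  by rewrite vE //; apply: (sm_g_periodic sm') => //; lia.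
have dw x : x \in `]Ledge H x0 j, Redge H x0 j[ -> is_derive x 1 w (- D / c).
  move=> xo; have xc : x \in element j by exact: subset_itv_oo_cc xo.
  have p1 := sm_pde sm np UN xo; have p2 := sm_pde sm' np UN xo.
  have d1 := sm_derivable sm np UN xo; have d2 := sm_derivable sm' np UN xo.
  apply: DeriveDef; first exact: derivableB.
  rewrite deriveB // -!derive1E -(dtE x xc).
  apply: (mulfI c0); rewrite mulrCA divff // mulr1; lra.
have cw : {within `[Ledge H x0 j, Redge H x0 j], continuous w}.
  by move=> x; apply: cvgB; [exact: (sm_continuous sm) | exact: (sm_continuous sm')].
(* The jumps across the element depend on lower orders only, where the two manifolds agree. *)
have edges : w (Redge H x0 j) = w (Ledge H x0 j).
  have E1 := slow_manifold_edges sm j np UN.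
  have E2 := slow_manifold_edges sm' j np UN.
  suff : v n U j (Redge H x0 j) - v n U j (Ledge H x0 j) =
    v' n U j (Redge H x0 j) - v' n U j (Ledge H x0 j) by rewrite /w; lra.
  rewrite E1 E2; case: n np {IH D w dtE dw cw E1 E2} gE vE => // k np gE vE.
  have lj i : Ledge H x0 i \in element i by rewrite bound_itvE ltW ?Ledge_lt_Redge.
  have rj i : Redge H x0 i \in element i by rewrite bound_itvE ltW ?Ledge_lt_Redge.
  by rewrite !vE.
(* Equal end values and the constant slope [- D / c] force [D = 0] by the mean value theorem. *)
have D0 : D = 0.
  have [y _] := MVT LR dw cw; rewrite edges subrr => /esym/eqP.
  rewrite mulf_eq0 subr_eq0 (gt_eqF LR) orbF mulf_eq0 invr_eq0 (negbTE c0) orbF.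
  by rewrite oppr_eq0 => /eqP.
split; first by apply/eqP; rewrite -subr_eq0 -/D D0.
pose K := w (Ledge H x0 j).
have wK x : x \in element j -> w x = K.
  rewrite in_itv /= => /andP[]; rewrite le_eqVlt => /predU1P[<- //|Lx xR].
  have [||y _] := @MVT R w (fun=> - D / c) (Ledge H x0 j) x Lx.
  - move=> y; rewrite in_itv /= => /andP[Ly yx]; apply: dw.
    by rewrite in_itv /= Ly (lt_le_trans yx).
  - apply: continuous_subspaceW cw => y /=; rewrite !in_itv /= => /andP[-> yx] /=.
    exact: le_trans yx xR.
  - by rewrite D0 oppr0 mul0r mul0r => /eqP; rewrite subr_eq0 => /eqP.
(* The remaining constant [K] enters the field polynomial; comparing grid values gives
   [K * moment 0 = 0], and the zeroth moment is 1. *)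
have vK : {in element j, forall x,
    v n U j x = (field_poly H theta kind n U j + K%:P).[x - midpoint x0 H j]}.
  by move=> x xj; rewrite hornerD hornerC -(wK x xj) /w /slow_field; ring.
have G1 := sm_grid_value sm j np UN.
have G2 := sm_grid_value sm' j np UN.
rewrite -G2 in G1.
have f' : {in element j, forall x,
    v' n U j x = (field_poly H theta kind n U j).[x - midpoint x0 H j]} by [].
move: G1; rewrite (grid_value_horner hH kind vK (m := n.+1)); last first.
  rewrite (leq_trans (size_polyD _ _)) // geq_max size_poly.
  by rewrite (leq_trans (size_polyC_leq1 _)).
rewrite (grid_value_horner hH kind f' (size_poly _ _)).
under eq_bigr do rewrite coefD mulrDl.
rewrite big_split /= [X in _ + X]big_ord_recl coefC moment0 // mulr1.
rewrite [X in _ + (_ + X)]big1 => [|i _]; last by rewrite coefC mul0r.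
rewrite addr0 => /eqP; rewrite -subr_eq0 addrAC subrr add0r => /eqP K0.
by move=> x xj; rewrite vK // K0 addr0.
Qed.

Lemma slow_manifold_rate v g : slow_manifold c H theta x0 N kind v g p ->
  forall n U j, (n < p)%N -> grid_periodic N U -> g n U j = g' n U j.
Proof.
move=> sm n U j np UN; have [c0|c0] := eqVneq c 0; last first.
  by have [] := slow_manifold_unique c0 sm j np UN.
(* For [c = 0] the canonical rate vanishes too, through the prefactor [- 2 c / H]. *)
rewrite (slow_manifold_no_wave c0 sm) // /slow_rate holistic_coefE c0.
by rewrite mulr0 mul0r oppr0 rmorph0 mul0r grid_op0.
Qed.
End Uniqueness.

(** Existence keeps the second clause from being vacuous; that clause identifies the evolution on
    every slow manifold with the truncated closed form, to which the stencil and consistency clauses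
    apply. *)
Theorem mainTheorem10 (R : realType) (c H theta x0 : R) (N p : nat)
    (kind : grid_value_kind) (hH : 0 < H) (hN : (0 < N)%N) (hp : (0 < p)%N) :
  [/\ exists v g, slow_manifold c H theta x0 N kind v g p,
      (forall v g, slow_manifold c H theta x0 N kind v g p ->
        forall (gamma : R) (V : R -> R),
          grid_periodic N (fun j : int => V j%:~R) ->
          forall j : int,
            \sum_(n < p) gamma ^+ n * g n (fun i : int => V i%:~R) j
            = holistic_rhs c H theta p gamma V j%:~R),
      (forall gamma : R,
        stencil_width_2p_minus_1 p (holistic_rhs c H theta p gamma))
    & consistent_with_wave c p (equivalent_pde c H theta p 1)].
Proof.
split.
- exists (slow_field H theta x0 kind), (slow_rate c H theta).
  exact: slow_field_is_slow_manifold.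
- move=> v g sm gamma V VN j; apply: eq_bigr => n _; congr (_ * _).
  (* The coefficients are local, so their action at grid points depends only on the grid values of
     [V]. *)
  rewrite (slow_manifold_rate hH sm) // /slow_rate -grid_opE //.
  exact: holistic_coef_local.
- by move=> gamma; exact: holistic_stencil.
- by apply: holistic_consistent; rewrite gt_eqF.
Qed.
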